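(* There exists a function $v^*\in\widehat{\mathcal A}$ that solves the Bellman equation $$v^*(s)=\sup_{a\in A(s)}\left((1-\beta)u(s,a)^p+\beta\left[\frac1r\ln\int_S e^{rv^*(s')}q(ds'|s,a)\right]^p\right)^{1/p}\quad\text{for all } s\in S.$$
   Context: Model. $S$ (states) and $A$ (actions) are Borel spaces, i.e. non-empty Borel subsets of complete separable metric spaces. $\mathbb K\subset S\times A$ is a non-empty Borel set such that each section $A(s)=\{a\in A:(s,a)\in\mathbb K\}$, $s\in S$, is non-empty. $q$ is a Borel measurable transition probability from $\mathbb K$ to $S$. $u:\mathbb K\to\mathbb R$ is Borel measurable with $b_0\le u(s,a)\le b_1$ for all $(s,a)\in\mathbb K$, where $b_1>b_0>0$ are constants. $\beta\in[0,1)$, $r<0$, and $p<1$, $p\ne0$ are fixed real parameters. Constants. $0<\epsilon<B$ are fixed constants chosen as follows: if $p<0$, then $\epsilon\le b_0$ and $B\ge(1-\beta)^{1/p}b_1$; if $p\in(0,1)$, then $\epsilon\le(1-\beta)^{1/p}b_0$ and $B\ge b_1$. Function class. A subset of a Borel space $Y$ is analytic if it is the projection onto $Y$ of a Borel subset of $Y\times Y$. A function $g:Y\to\mathbb R$ is upper semianalytic if $\{y:g(y)>c\}$ is analytic for every $c\in\mathbb R$ (such functions are universally measurable; integrals are taken with respect to completed measures). $\widehat{\mathcal A}$ is the set of all upper semianalytic functions $v:S\to[\epsilon,B]$. *)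

(* Defs.v *)
From HB Require Import structures.
From mathcomp Require Import all_boot all_order all_algebra.
From mathcomp Require Import all_classical all_reals all_analysis.
Set Implicit Arguments.
Unset Strict Implicit.
Unset Printing Implicit Defensive.
Import Order.TTheory GRing.Theory Num.Theory.
Import numFieldNormedType.Exports.
Local Open Scope classical_set_scope.
Local Open Scope ring_scope.

#[short(type="completeMetricType")]
HB.structure Definition CompleteMetric (R : numDomainType) :=
  { T of Metric R T & Complete T }.

Definition separable (T : topologicalType) : Prop :=
  exists2 D : set T, countable D & dense D.

Definition borel_set (T : topologicalType) (E : set T) : Prop := <<s open >> E.

(* Non-empty Borel subsets. Such a subset coerces to a type, whose topology is
   the subspace topology; it is pointed because measurable types have to be. *)
Record borelSubset (T : topologicalType) := BorelSubset {
  carrier : set T ;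
  borel_carrier : borel_set carrier ;
  carrier_neq0 : carrier !=set0 }.

Definition borel_subtype (T : topologicalType) (E : borelSubset T) : Type :=
  set_type (carrier E).
Coercion borel_subtype : borelSubset >-> Sortclass.

Section borel_subtype_instances.
Variables (T : topologicalType) (E : borelSubset T).

Definition borel_subtype_point : E :=
  let: exist x Ex := cid (carrier_neq0 E) in exist _ x (mem_set Ex).

HB.instance Definition _ :=
  Topological.copy (borel_subtype E) (set_type (carrier E)).
HB.instance Definition _ := isPointed.Build (borel_subtype E) borel_subtype_point.

Definition to_subtype (x : T) (Ex : carrier E x) : E := exist _ x (mem_set Ex).

End borel_subtype_instances.

(* T with its Borel sigma-algebra as the canonical measurable structure. *)
Notation borel T := (g_sigma_algebraType (@open T)).

Definition analytic (Y : topologicalType) (E : set Y) : Prop :=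
  exists2 D : set (Y * Y), borel_set D & E = fst @` D.

Definition upper_semianalytic (R : realType) (Y : topologicalType)
    (g : Y -> R) : Prop :=
  forall c : R, analytic [set y | c < g y].

(* Integral with respect to the completion of [mu]: for a finite measure on a
   sigma-algebra, the Caratheodory-measurable sets of the outer measure
   [mu^*] form the completed sigma-algebra, and [mu^*] restricted to them is
   the completed measure. *)
Definition completed_integral (d : measure_display) (T : measurableType d)
    (R : realType) (mu : {measure set T -> \bar R}) (f : T -> R) : \bar R :=
  (\int[@completed_measure_extension _ _ _ mu]_t (f t)%:E)%E.

Section bellman.
Variables (R : realType) (S A : ptopologicalType) (K : borelSubset (S * A)%type).
Variables (q : R.-pker (borel K) ~> (borel S)) (u : K -> R).
Variables (beta r p : R).

Definition actions (s : S) : set A := [set a | carrier K (s, a)].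

Definition certainty_equivalent (v : S -> R) (k : K) : R :=
  r^-1 * ln (fine (completed_integral (q k) (fun s' => expR (r * v s')))).

Definition aggregate (v : S -> R) (k : K) : R :=
  ((1 - beta) * u k `^ p + beta * certainty_equivalent v k `^ p) `^ p^-1.

(* The supremum is taken in the extended reals, hence the equation also says
   that it is finite. *)
Definition bellman_equation (v : S -> R) : Prop :=
  forall s : S,
    (v s)%:E = ereal_sup
      [set y | exists (a : A) (Ka : actions s a),
                 y = (aggregate v (to_subtype Ka))%:E].

End bellman.

Definition value_class (R : realType) (S : topologicalType) (eps B : R)
    (v : S -> R) : Prop :=
  upper_semianalytic v /\ forall s : S, eps <= v s <= B.

(* Main.v *)
(* The Bellman operator is monotone, preserves upper semianalytic functions with
   values in [eps, B] and commutes with increasing limits, so its iterates from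
   the constant eps increase to a solution; no contraction is involved.

   Semianalyticity is handled through Souslin schemes of measurable sets.  For a
   finite measure mu and a set E given by a scheme F, the outer measure of E
   exceeds c iff for some branch y and some c' > c all the finite unions of sets
   of F over words bounded by y up to n have measure at least c': one direction
   is continuity of the outer measure from below, the other is Koenig's lemma.
   This condition is again a Souslin scheme in the parameter of a kernel, and it
   also yields the measurability of E for the completion of mu.  Projecting
   along the actions uses completeness of the action space.  A set given by a Souslin
   scheme of Borel sets of S is analytic, i.e. the projection of a Borel subset
   of S x S, since an uncountable S carries a Cantor scheme and therefore a
   Borel partial map onto the space of branches. *)

Require Import Defs.
From HB Require Import structures.
From mathcomp Require Import all_boot all_order all_algebra.
From mathcomp Require Import all_classical all_reals all_analysis.
From mathcomp Require Import measurable_realfun ring.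
Set Implicit Arguments.
Unset Strict Implicit.
Unset Printing Implicit Defensive.
Import Order.TTheory GRing.Theory Num.Theory.
Import numFieldNormedType.Exports.
Local Open Scope classical_set_scope.
Local Open Scope ring_scope.

(** * Souslin schemes *)

Definition suslin (T : Type) (H : set (set T)) (E : set T) : Prop :=
  exists2 F : seq nat -> set T, (forall w, H (F w)) &
    E = [set t | exists x : nat -> nat, forall n, F (mkseq x n) t].

Lemma injective_unbounded (f : nat -> nat) (n : nat) :
  injective f -> exists b, (n <= f b)%N.
Proof.
move=> f_inj; apply: contrapT => /forallNP fn.
have fn' (b : 'I_n.+1) : (f b < n)%N by rewrite ltnNge; apply/negP/fn.
have : injective (fun b : 'I_n.+1 => Ordinal (fn' b)).
  by move=> b b' /(congr1 val) /= /f_inj /val_inj.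
by move/leq_card; rewrite !card_ord ltnn.
Qed.

Lemma eq_mkseq_lt (A : Type) (f g : nat -> A) n :
  (forall i, (i < n)%N -> f i = g i) -> mkseq f n = mkseq g n.
Proof.
by move=> fg; apply/eq_in_map => i; rewrite mem_iota add0n => /andP[_ /fg].
Qed.

Section suslin_theory.
Variables (T : Type) (H : set (set T)).
Hypothesis HT : H setT.

(* The word of length [pickle (i, b)] enforces the condition [G i], [b] being
   large enough for the word to contain all the letters [G i] depends on. *)
Lemma suslin_finitely_determined (I J : countType)
    (G : I -> (J -> nat) -> set T) :
  (forall i, exists js : seq J,
     forall z z', {in js, z =1 z'} -> G i z = G i z') ->
  (forall i z, H (G i z)) ->
  suslin H [set t | exists z, forall i, G i z t].
Proof.
move=> /choice[js Gjs] HG.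
pose F (w : seq nat) : set T :=
  if @unpickle (I * nat)%type (size w) is Some (i, _) then
    if all (fun j => (pickle j < size w)%N) (js i)
    then G i (fun j => nth 0%N w (pickle j)) else setT
  else setT.
exists F.
  by move=> w; rewrite /F; case: unpickle => [[i b]|]//; case: ifP.
apply/seteqP; split=> t /=.
- move=> [z Gz]; exists (fun n => oapp z 0%N (pickle_inv n)) => n.
  rewrite /F size_mkseq; case: unpickle => [[i b]|]//; case: ifP => // /allP ltn.
  rewrite (Gjs i _ z)// => j /ltn jn.
  by rewrite nth_mkseq// pickleK_inv.
- move=> [x Fx]; exists (x \o pickle) => i.
  pose n0 := (\max_(j <- js i) pickle j).+1.
  have [b nb] : exists b : nat, (n0 <= pickle (i, b))%N.
    apply: (injective_unbounded (f := fun b => pickle (i, b))).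
    by move=> b b' /(pcan_inj pickleK) [].
  have := Fx (pickle (i, b)); rewrite /F size_mkseq pickleK.
  have ltn j : j \in js i -> (pickle j < pickle (i, b))%N.
    move=> jj; apply: leq_trans nb; rewrite ltnS.
    by rewrite (big_rem j)//= leq_maxl.
  case: ifP => [_|/negbT/negP []]; last by apply/allP.
  rewrite (Gjs i _ (x \o pickle))// => j /ltn jn.
  by rewrite nth_mkseq.
Qed.

Lemma sub_suslin : H `<=` suslin H.
Proof.
move=> E HE; exists (fun=> E) => //; apply/seteqP; split => t /=.
  by move=> Et; exists id.
by case=> x /(_ 0%N).
Qed.

(** One extra letter, at [None], chooses the index of the union; the other letters form a branch of
    the chosen scheme. *)
Lemma suslin_bigcup (E : nat -> set T) :
  (forall i, suslin H (E i)) -> suslin H (\bigcup_i E i).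
Proof.
move=> /(fun h i => cid2 (h i)) EF.
pose F i := sval (EF i).
have HF i w : H (F i w) by rewrite /F; case: (EF i).
have FE i : E i = [set t | exists x : nat -> nat, forall n, F i (mkseq x n) t].
  by rewrite /F; case: (EF i).
rewrite [X in suslin _ X](_ : _ = [set t | exists z : option nat -> nat,
  forall n, F (z None) (mkseq (z \o Some) n) t]).
  apply: suslin_finitely_determined => // n.
  exists (None :: map Some (iota 0 n)) => z z' zz'.
  rewrite -zz' ?mem_head//; congr F; apply: eq_mkseq_lt => i ni /=.
  by apply: zz'; rewrite inE map_f// mem_iota.
apply/seteqP; split => t /=.
- move=> [i _]; rewrite FE /= => -[x Fx]; exists (oapp x i) => n.
  exact: Fx.
- move=> [z Fz]; exists (z None) => //; rewrite FE /=; by exists (z \o Some).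
Qed.

(** A sequence of branches, one for each index, is a single function on pairs. *)
Lemma suslin_bigcap (E : nat -> set T) :
  (forall i, suslin H (E i)) -> suslin H (\bigcap_i E i).
Proof.
move=> /(fun h i => cid2 (h i)) EF.
pose F i := sval (EF i).
have HF i w : H (F i w) by rewrite /F; case: (EF i).
have FE i : E i = [set t | exists x : nat -> nat, forall n, F i (mkseq x n) t].
  by rewrite /F; case: (EF i).
rewrite [X in suslin _ X](_ : _ = [set t | exists z : nat * nat -> nat,
  forall i : nat * nat, F i.1 (mkseq (fun m => z (i.1, m)) i.2) t]).
  apply: suslin_finitely_determined => // -[i n].
  exists (map (pair i) (iota 0 n)) => z z' zz'.
  congr F; apply: eq_mkseq_lt => m mn /=.
  by apply: zz'; rewrite map_f// mem_iota.
apply/seteqP; split => t /=.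
- move=> Et.
  have /choice[x Fx] : forall i, exists x : nat -> nat, forall n, F i (mkseq x n) t.
    by move=> i; have := Et i I; rewrite FE.
  by exists (fun i => x i.1 i.2) => -[i n]; apply: Fx.
- move=> [z Fz] i _; rewrite FE /=; exists (fun m => z (i, m)) => n.
  exact: (Fz (i, n)).
Qed.

Lemma suslinU E1 E2 : suslin H E1 -> suslin H E2 -> suslin H (E1 `|` E2).
Proof.
move=> S1 S2.
rewrite (_ : _ `|` _ = \bigcup_i (if i is 0%N then E1 else E2)).
  by apply: suslin_bigcup => -[].
apply/seteqP; split => t.
  by move=> [?|?]; [exists 0%N|exists 1%N].
by move=> [[|i] _ ?]; [left|right].
Qed.

Lemma suslinI E1 E2 : suslin H E1 -> suslin H E2 -> suslin H (E1 `&` E2).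
Proof.
move=> S1 S2.
rewrite (_ : _ `&` _ = \bigcap_i (if i is 0%N then E1 else E2)).
  by apply: suslin_bigcap => -[].
apply/seteqP; split => t.
  by move=> [? ?] [|i].
by move=> Et; split; [exact: (Et 0%N)|exact: (Et 1%N)].
Qed.

(** The left letters carry the outer branch, the right ones an inner branch for each initial word of
    it; every condition reads finitely many letters. *)
Lemma suslin_idem : suslin (suslin H) `<=` suslin H.
Proof.
move=> E [F /(fun h w => cid2 (h w)) FF ->].
pose F' w := sval (FF w).
have HF w w' : H (F' w w') by rewrite /F'; case: (FF w).
have FE w : F w = [set t | exists x : nat -> nat, forall n, F' w (mkseq x n) t].
  by rewrite /F'; case: (FF w).
rewrite [X in suslin _ X](_ : _ = [set t | exists z : nat + nat * nat -> nat,
  forall i : nat * nat, F' (mkseq (z \o inl) i.1)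
    (mkseq (fun m => z (inr (i.1, m))) i.2) t]).
  apply: suslin_finitely_determined => // -[i n].
  exists (map inl (iota 0 i) ++ map (inr \o pair i) (iota 0 n)) => z z' zz'.
  rewrite (@eq_mkseq_lt _ _ (z' \o inl) i)//=.
    congr F'; apply: eq_mkseq_lt => m mn /=.
    apply: zz'; rewrite mem_cat (map_f (inr \o pair i)) ?orbT//.
    by rewrite mem_iota.
  by move=> m mi; apply: zz'; rewrite mem_cat map_f// mem_iota.
apply/seteqP; split => t /=.
- move=> [x Fx].
  have /choice[y Fy] : forall n, exists y : nat -> nat, forall m,
      F' (mkseq x n) (mkseq y m) t.
    by move=> n; have := Fx n; rewrite FE.
  exists (fun j => match j with inl n => x n | inr i => y i.1 i.2 end).
  by move=> -[n m] /=; apply: Fy.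
- move=> [z Fz]; exists (z \o inl) => n; rewrite FE /=.
  by exists (fun m => z (inr (n, m))) => m; have := Fz (n, m).
Qed.

End suslin_theory.

Lemma suslin_sigma_algebra T (H G : set (set T)) : H setT -> H set0 ->
  G `<=` suslin H -> (forall A, G A -> suslin H (~` A)) ->
  <<s G >> `<=` suslin H.
Proof.
move=> HT H0 GH GCH.
suff : <<s G >> `<=` [set E | suslin H E /\ suslin H (~` E)].
  by move=> h E /h[].
apply: smallest_sub => [|A GA]; last by split; [exact: GH|exact: GCH].
split => /=.
- by rewrite setC0; split; apply: sub_suslin.
- by move=> A [SA SCA]; rewrite setTD setCK.
- move=> A SA; split; first by apply: suslin_bigcup => // i; case: (SA i).
  by rewrite setC_bigcup; apply: suslin_bigcap => // i; case: (SA i).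
Qed.

(** * Closed schemes in Polish spaces *)

Lemma suslin_bigcup_countable T (H : set (set T)) (I : countType) (D : set I)
    (E : I -> set T) : H setT -> H set0 ->
  (forall i, D i -> suslin H (E i)) -> suslin H (\bigcup_(i in D) E i).
Proof.
move=> HT H0 SE; pose E' n := if @unpickle I n is Some i then
  (if `[< D i >] then E i else set0) else set0.
rewrite (_ : \bigcup_(i in D) _ = \bigcup_n E' n).
  apply: suslin_bigcup => // n; rewrite /E'; case: unpickle => [i|].
    by case: asboolP => [/SE//|_]; exact: sub_suslin.
  exact: sub_suslin.
apply/seteqP; split => t.
  by move=> [i Di Et]; exists (pickle i) => //; rewrite /E' pickleK asboolT.
move=> [n _]; rewrite /E'; case: unpickle => [i|]//.
by case: asboolP => // Di Et; exists i.
Qed.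

Section polish.
Variables (R : realType).

(** The n-th closed set removes a neighbourhood of the complement made of balls of radius 1/(n+1).
    Interiors are taken because balls need not be open. *)
Lemma open_Fsigma (X : pseudoMetricType R) (U : set X) : open U ->
  exists2 C : nat -> set X, (forall n, closed (C n)) & U = \bigcup_n C n.
Proof.
move=> oU; exists (fun n => ~` \bigcup_(y in ~` U) (ball y n.+1%:R^-1)°).
  move=> n; apply: open_closedC; apply: bigcup_open => y _.
  exact: open_interior.
apply/seteqP; split => x.
- move=> Ux; have : nbhs x U by exact: open_nbhs_nbhs.
  move/nbhs_ballP => [e /= e0 xeU].
  have [n] := ltr_add_invr e0; rewrite add0r => ne.
  exists n => // -[y nUy /interior_subset /ball_sym xy]; apply: nUy.
  by apply: xeU; apply: le_ball xy; exact: ltW.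
- move=> [n _ nUx]; apply: contrapT => Ux; apply: nUx; exists x => //.
  by apply/nbhs_ballP; exists n.+1%:R^-1 => /=.
Qed.

Lemma separable_seq (X : pseudoMetricType R) : separable X -> [set: X] !=set0 ->
  exists d : nat -> X, forall x (e : R), 0 < e -> exists n, ball (d n) e x.
Proof.
move=> [D cD dD] [x0 _].
have [d Dd] : exists d : nat -> X, D `<=` range d.
  pose PT : pointedType := HB.pack_for pointedType X (isPointed.Build X x0).
  have [->|/set0P D0] := eqVneq D set0; first by exists (fun=> x0).
  move: cD => /(@pcard_surjP PT) [f].
  by move=> Df; exists f => x /Df [n _ <-]; exists n.
exists d => x e e0.
have [|y [] ] := dD (ball x e)° _ (open_interior _).
  by exists x; exact: (nbhsx_ballx _ _ e0).
by move=> /interior_subset xy /Dd [n _ dn]; exists n; rewrite dn; exact: ball_sym.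
Qed.

Lemma separable_base (X : pseudoMetricType R) : separable X ->
  exists U : nat -> set X, (forall n, open (U n)) /\
    forall x (V : set X), nbhs x V -> exists n, U n x /\ U n `<=` V.
Proof.
move=> sX; have [X0|/set0P[x0 _]] := eqVneq [set: X] set0.
  exists (fun=> setT); split; first by move=> _; exact: openT.
  by move=> x; have : [set: X] x by []; rewrite X0.
have [|d Hd] := separable_seq sX; first by exists x0.
pose U i := oapp (fun nk : nat * nat => (ball (d nk.1) nk.2.+1%:R^-1)°) setT
  (@unpickle (nat * nat)%type i).
exists U; split.
  by move=> i; rewrite /U; case: unpickle => [nk|] /=;
    [exact: open_interior|exact: openT].
move=> x V /nbhs_ballP[e /= e0 xeV].
(* The radius 1/(m+1) is below half of 1/(k+1), itself below [e]: a basic ball of that radius whose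
   centre is within half of it from [x] surrounds [x] and stays in [V]. *)
have [k] := ltr_add_invr e0; rewrite add0r => ke.
have k20 : 0 < k.+1%:R^-1 / 2 :> R by rewrite divr_gt0.
have [m] := ltr_add_invr k20; rewrite add0r => mk.
have k40 : 0 < m.+1%:R^-1 / 2 :> R by rewrite divr_gt0.
have [n dnx] := Hd x _ k40.
exists (pickle (n, m)); rewrite /U pickleK /=; split.
  apply/nbhs_ballP; exists (m.+1%:R^-1 / 2) => //= y xy.
  by rewrite [m.+1%:R^-1]splitr; exact: ball_triangle xy.
move=> y /interior_subset dny; apply: xeV.
apply: (@le_ball _ _ _ (m.+1%:R^-1 + m.+1%:R^-1)).
  apply: le_trans (ltW ke); rewrite [k.+1%:R^-1]splitr; exact: lerD (ltW mk) (ltW mk).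
apply: ball_triangle dny; apply: ball_sym; apply: le_ball dnx.
by rewrite ler_pdivrMr// ler_peMr// ler1n.
Qed.

Lemma borel_suslin (X : pseudoMetricType R) : @borel_set X `<=` suslin closed.
Proof.
apply: suslin_sigma_algebra; [exact: closedT|exact: closed0| |].
  move=> U /open_Fsigma[C cC ->]; apply: suslin_bigcup; first exact: closedT.
  by move=> i; apply: sub_suslin; exact: cC.
by move=> U oU; apply: sub_suslin; exact: open_closedC.
Qed.

Lemma closure_ball_sub (X : pseudoMetricType R) (x : X) (e : R) : 0 < e ->
  closure (ball x e) `<=` ball x (e + e).
Proof.
move=> e0 y /(_ (ball y e)) [|z [xz /ball_sym zy]].
  exact: (nbhsx_ballx _ _ e0).
exact: ball_triangle xz zy.
Qed.

(* Each letter codes a pair: the first components run through a closed scheme of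
   [E], the second ones pick a cover by balls of vanishing radii. *)
Lemma borel_small_scheme (X : pseudoMetricType R) (E : set X) :
  separable X -> [set: X] !=set0 -> borel_set E ->
  exists G : seq nat -> set X, [/\ forall w, closed (G w),
    forall x (e : R), 0 < e ->
      exists N, forall n, (N <= n)%N -> exists c, G (mkseq x n) `<=` ball c e &
    E = [set t | exists x : nat -> nat, forall n, G (mkseq x n) t]].
Proof.
move=> sX X0 /borel_suslin[F cF ->]; have [d Hd] := separable_seq sX X0.
pose letter (l : nat) : nat * nat := odflt (0, 0)%N (unpickle l).
pose G (w : seq nat) := F (map (fst \o letter) w) `&`
  (if size w is n.+1 then closure (ball (d (letter (last 0%N w)).2) n.+1%:R^-1)
   else setT).
have mapE (x : nat -> nat) n :
    map (fst \o letter) (mkseq x n) = mkseq (fst \o letter \o x) n.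
  by rewrite /mkseq -map_comp.
have lastE (x : nat -> nat) n : last 0%N (mkseq x n.+1) = x n.
  by rewrite mkseqS last_rcons.
exists G; split.
- move=> w; apply: closedI => //; case: (size w) => [|n].
    exact: closedT.
  exact: closed_closure.
- move=> x e e0; have e20 : 0 < e / 2 by rewrite divr_gt0.
  have [N] := ltr_add_invr e20; rewrite add0r => Ne.
  exists N.+1 => -[//|n] Nn; exists (d (letter (x n)).2).
  move=> y; rewrite /G size_mkseq lastE.
  move=> [_ /closure_ball_sub -/(_ ltac:(by []))].
  apply: le_ball; rewrite [e]splitr.
  have nN : n.+1%:R^-1 <= N.+1%:R^-1 :> R.
    by rewrite lef_pV2 ?posrE// ler_nat.
  by rewrite lerD// (le_trans nN)// ltW.
- apply/seteqP; split => t [x Hx].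
  + have /choice[c dc] n := Hd t n.+1%:R^-1 ltac:(by []).
    exists (fun n => pickle (x n, c n)) => n.
    have letterK i : letter (pickle (x i, c i)) = (x i, c i).
      by rewrite /letter pickleK.
    rewrite /G size_mkseq mapE (_ : mkseq _ n = mkseq x n); last first.
      by apply: eq_mkseq_lt => i _ /=; rewrite letterK.
    split; first exact: Hx.
    case: n => [|n]; first exact: I.
    rewrite lastE letterK.
    by apply: subset_closure; exact: dc.
  + exists (fst \o letter \o x) => n.
    by have := Hx n; rewrite /G mapE => -[].
Qed.

(** Cantor's intersection theorem for sets that need not decrease: points of the finite
    intersections form a Cauchy sequence, since arbitrarily small balls contain some [C n]. *)
Lemma complete_bigcap (X : completeMetricType R) (C : nat -> set X) :
  (forall n, closed (C n)) ->
  (forall e : R, 0 < e -> exists n x, C n `<=` ball x e) ->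
  (forall n, exists x, forall m, (m <= n)%N -> C m x) ->
  exists x, forall n, C n x.
Proof.
move=> cC Csmall /choice[x Cx].
have cx : cvg (x @ \oo).
  apply: cauchy_cvg; apply: cauchy_exP => e e0.
  have [n [y Cy]] := Csmall e e0; exists y.
  by exists n => // m /= nm; apply/Cy/Cx.
exists (lim (x @ \oo)) => n.
apply: (closed_cvg (C n) (cC n) _ _ cx).
by exists n => // m /= nm; exact: Cx.
Qed.

End polish.

(** * Projections *)

Definition inclusion (T : topologicalType) (E : borelSubset T) (x : E) : T :=
  set_val (x : set_type (carrier E)).

Lemma inclusion_carrier (T : topologicalType) (E : borelSubset T) (x : E) :
  carrier E (inclusion x).
Proof. exact: set_valP. Qed.

Lemma inclusionK (T : topologicalType) (E : borelSubset T) (x : E)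
  (Ex : carrier E (inclusion x)) : to_subtype Ex = x.
Proof. exact: eq_sig_hprop. Qed.

Lemma open_subtypeP (T : topologicalType) (E : borelSubset T) (V : set E) :
  open V <-> exists2 O : set T, open O & V = @inclusion T E @^-1` O.
Proof.
split; first by case=> O oO <-; exists O.
by case=> O oO ->; exists O.
Qed.

(** Traces of Borel sets form a sigma-algebra containing the open sets of [E], and the sets with
    Borel trace form one containing the open sets of [T]. *)
Lemma borel_subtypeP (T : topologicalType) (E : borelSubset T) (V : set E) :
  borel_set V <-> exists2 O : set T, borel_set O & V = @inclusion T E @^-1` O.
Proof.
split.
- pose P := preimage_set_system [set: E] (@inclusion T E) (@borel_set T).
  suff : @borel_set E `<=` P.
    by move=> BP /BP[U bU <-]; exists U; rewrite ?setTI.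
  apply: smallest_sub.
    apply: sigma_algebra_preimage; exact: smallest_sigma_algebra.
  move=> U /open_subtypeP[W oW ->]; exists W; last by rewrite setTI.
  exact: sub_sigma_algebra.
- move=> [W + ->]; move: W.
  pose P := image_set_system [set: E] (@inclusion T E) (@borel_set E).
  suff : @borel_set T `<=` P.
    by move=> h O /h; rewrite /P /image_set_system /= setTI.
  apply: smallest_sub.
    apply: sigma_algebra_image; exact: smallest_sigma_algebra.
  move=> U oU; rewrite /P /image_set_system /= setTI; apply: sub_sigma_algebra.
  by apply/open_subtypeP; exists U.
Qed.

Section projection.
Variables (R : realType) (X Y : completeMetricType R).
Hypotheses (hX : separable X) (hY : separable Y).
Variables (S : borelSubset X) (A : borelSubset Y).

(** The second side is closed in the complete space [Y], not merely in [A], so that completeness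
    applies when it is projected away. *)
Definition borel_closed_rectangle (E : set (S * A)) : Prop :=
  exists B C, [/\ @borel_set S B, @closed Y C &
    E = [set sa | B sa.1 /\ C (inclusion sa.2)]].

Local Notation rect := borel_closed_rectangle.

Lemma borel_setT (T : topologicalType) : borel_set [set: T].
Proof. by apply: sub_sigma_algebra; exact: openT. Qed.

Lemma rectT : rect setT.
Proof.
exists setT, setT; split; [exact: borel_setT|exact: closedT|].
by apply/seteqP; split.
Qed.

Lemma rect0 : rect set0.
Proof.
exists setT, set0; split; [exact: borel_setT|exact: closed0|].
by apply/seteqP; split => // -[? ?] [].
Qed.

(** By separability the countable family [G] of basic rectangles generates the Borel sets of the
    product. The complement of a basic rectangle is a union of two rectangles of the required
    form. *)
Lemma borel_prod_suslin : @borel_set (S * A)%type `<=` suslin rect.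
Proof.
have [U [oU UP]] := separable_base hX.
have [V [oV VP]] := separable_base hY.
pose G : set (set (S * A)) := [set E | exists2 nm : nat * nat, True &
  E = [set sa | U nm.1 (inclusion sa.1) /\ V nm.2 (inclusion sa.2)]].
have GS : <<s G >> `<=` suslin rect.
  apply: suslin_sigma_algebra; [exact: rectT|exact: rect0| |].
    move=> _ [[n m] _ -> /=]; have [C cC ->] := open_Fsigma (oV m).
    rewrite (_ : mkset _ = \bigcup_i
        [set sa : S * A | U n (inclusion sa.1) /\ C i (inclusion sa.2)]).
      apply: suslin_bigcup; first exact: rectT.
      move=> i; apply: sub_suslin; exists (@inclusion _ _ @^-1` U n), (C i).
      split => //; apply: sub_sigma_algebra; apply/open_subtypeP.
      by exists (U n).
    apply/seteqP; split => -[s a] /=.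
      by move=> [Us [i _ Ca]]; exists i.
    by move=> [i _ [Us Ca]]; split => //; exists i.
  move=> _ [[n m] _ -> /=].
  rewrite (_ : ~` _ = [set sa | ~ U n (inclusion sa.1)] `|`
                      [set sa | ~ V m (inclusion sa.2)]); last first.
    by rewrite -[RHS]setCI; congr (~` _).
  apply: suslinU; first exact: rectT.
    apply: sub_suslin; exists (@inclusion _ _ @^-1` (~` U n)), setT.
    split; [|exact: closedT|by apply/seteqP; split => // -[? ?] []].
    apply/borel_subtypeP; exists (~` U n) => //; rewrite -setTD.
    by apply: sigma_algebraCD; apply: sub_sigma_algebra.
  apply: sub_suslin; exists setT, (~` V m).
  split => //; [exact: borel_setT|exact: open_closedC|].
  by apply/seteqP; split => // -[? ?] [].
apply: subset_trans GS; apply: smallest_sub.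
  exact: smallest_sigma_algebra.
move=> O oO; pose E (i : nat) : set (S * A) :=
  if @unpickle (nat * nat)%type i is Some nm then
    let W := [set sa | U nm.1 (inclusion sa.1) /\ V nm.2 (inclusion sa.2)] in
    if `[< W `<=` O >] then W else set0
  else set0.
rewrite (_ : O = \bigcup_i E i); last first.
  apply/seteqP; split => -[s a].
    move=> Osa; have : nbhs (s, a) O by exact: open_nbhs_nbhs.
    move=> [[/= P Q] [nP nQ] PQ].
    have [P' oP' [P's P'P]] : exists2 P' : set X, open P' &
        P' (inclusion s) /\ @inclusion _ _ @^-1` P' `<=` P.
      move: nP; rewrite nbhsE => -[_ [/open_subtypeP[P' oP' ->] ? ?]].
      by exists P'.
    have [Q' oQ' [Q's Q'Q]] : exists2 Q' : set Y, open Q' &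
        Q' (inclusion a) /\ @inclusion _ _ @^-1` Q' `<=` Q.
      move: nQ; rewrite nbhsE => -[_ [/open_subtypeP[Q' oQ' ->] ? ?]].
      by exists Q'.
    have [n [Uns UP']] := UP _ _ (open_nbhs_nbhs (conj oP' P's)).
    have [m [Vma VQ']] := VP _ _ (open_nbhs_nbhs (conj oQ' Q's)).
    exists (pickle (n, m)) => //; rewrite /E pickleK /= asboolT//.
    move=> -[s' a'] /= [Us' Va']; apply: PQ; split => /=.
      by apply: P'P; apply: UP'.
    by apply: Q'Q; apply: VQ'.
  move=> [i _]; rewrite /E; case: unpickle => [[n m]|]//.
  by case: asboolP => // WO; exact: WO.
apply: sigma_algebra_bigcup => i; rewrite /E; case: unpickle => [[n m]|].
  case: asboolP => // _; last exact: sigma_algebra0.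
  by apply: sub_sigma_algebra; exists (n, m).
exact: sigma_algebra0.
Qed.

(** A point [s] is in the projection iff, along some branch, [s] meets the conditions [B] and one
    action of [A] meets the closed conditions [C]. Running a scheme of small sets for [A] in
    parallel, completeness reduces the common action to nonempty finite intersections, a condition
    free of [s] that reads finitely many letters. *)
Lemma suslin_rectangle_projection (E : set (S * A)) : suslin rect E ->
  suslin (@borel_set S) (fst @` E).
Proof.
move=> [F /(fun h w => cid (h w)) FP ->].
pose B w := sval (FP w).
have /choice[C BC] : forall w, exists C, [/\ @borel_set S (B w), @closed Y C &
    F w = [set sa | B w sa.1 /\ C (inclusion sa.2)]].
  by move=> w; rewrite /B; case: (FP w).
have [|D [cD Dsmall AE]] := borel_small_scheme hY _ (borel_carrier A).
  by have [y _] := carrier_neq0 A; exists y.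
pose J : countType := (nat + nat)%type.
pose Q (z : J -> nat) n := C (mkseq (z \o inl) n) `&` D (mkseq (z \o inr) n).
pose nonempty_upto z n := exists a, forall m, (m <= n)%N -> Q z m a.
rewrite [X in suslin _ X](_ : _ = [set s | exists z : J -> nat, forall n,
    (if `[< nonempty_upto z n >] then B (mkseq (z \o inl) n) else set0) s]).
  apply: suslin_finitely_determined; first exact: borel_setT.
    move=> n; exists (map inl (iota 0 n) ++ map inr (iota 0 n)) => z z' zz'.
    have eql m : (m <= n)%N -> mkseq (z \o inl) m = mkseq (z' \o inl) m.
      move=> mn; apply: eq_mkseq_lt => i im; apply: zz'.
      by rewrite mem_cat map_f// mem_iota/= (leq_trans im).
    have eqr m : (m <= n)%N -> mkseq (z \o inr) m = mkseq (z' \o inr) m.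
      move=> mn; apply: eq_mkseq_lt => i im; apply: zz'.
      by rewrite mem_cat (map_f inr) ?orbT// mem_iota/= (leq_trans im).
    rewrite (_ : nonempty_upto z n = nonempty_upto z' n) ?eql//.
    by apply/propext; split => -[a Ha]; exists a => m mn;
      have := Ha _ mn; rewrite /Q eql// eqr.
  move=> n z; case: asboolP => _; last exact: sigma_algebra0.
  by have [] := BC (mkseq (z \o inl) n).
apply/seteqP; split => s /=.
- move=> [[s0 a] [x Fx] /= <-].
  have : carrier A (inclusion a) by exact: inclusion_carrier.
  rewrite AE => -[y Dy].
  have BCx n : B (mkseq x n) s0 /\ C (mkseq x n) (inclusion a).
    by have [_ _ Fn] := BC (mkseq x n); have := Fx n; rewrite Fn.
  exists (fun j => match j with inl n => x n | inr n => y n end) => n.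
  rewrite asboolT; first by case: (BCx n).
  exists (inclusion a) => m _; split; last exact: Dy.
  by case: (BCx m).
- move=> [z Hz].
  have HB n : nonempty_upto z n /\ B (mkseq (z \o inl) n) s.
    by have := Hz n; case: asboolP.
  have [a Qa] : exists a, forall n, Q z n a.
    apply: complete_bigcap => [n|e e0|n]; last by case: (HB n).
    - by apply: closedI => //; case: (BC (mkseq (z \o inl) n)).
    - have [n /(_ n (leqnn _)) [c Dc]] := Dsmall (z \o inr) _ e0.
      by exists n, c => a [_ /Dc].
  (* The limit point is found in [Y]; the right letters are a branch of the scheme of [A] and put it
     back in [A]. *)
  have Aa : carrier A a.
    by rewrite AE /=; exists (z \o inr) => n; have [] := Qa n.
  exists (s, to_subtype Aa) => //; exists (z \o inl) => n.
  have [_ _ ->] := BC (mkseq (z \o inl) n); split; first by case: (HB n).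
  by have [] := Qa n.
Qed.

Lemma suslin_projection (K : borelSubset (S * A)%type) (E : set K) :
  suslin (@borel_set K) E ->
  suslin (@borel_set S)
    [set s | exists (a : A) (Ka : actions K s a), E (to_subtype Ka)].
Proof.
move=> [F /(fun h w => cid2 ((borel_subtypeP _).1 (h w))) FP ->].
pose F' w := sval (FP w).
have bF' w : borel_set (F' w) by rewrite /F'; case: (FP w).
have FE w : F w = @inclusion _ _ @^-1` F' w by rewrite /F'; case: (FP w).
rewrite [X in suslin _ X](_ : _ = fst @` (carrier K `&`
    [set sa | exists x, forall n, F' (mkseq x n) sa])).
  apply: suslin_rectangle_projection; apply: suslinI; first exact: rectT.
    by apply: borel_prod_suslin; exact: borel_carrier.
  apply: suslin_idem; first exact: rectT.
  by exists F' => // w; exact: borel_prod_suslin.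
apply/seteqP; split => s /=.
- move=> [a [Ka [x Fx]]]; exists (s, a) => //; split => //; exists x => n.
  by have := Fx n; rewrite FE.
- move=> [[s0 a] [/= Ka [x Fx]] <-]; exists a, Ka, x => n.
  by rewrite FE; exact: Fx.
Qed.

End projection.

(** * Cantor schemes *)

Lemma take_mkseq (A : Type) (f : nat -> A) m n :
  (m <= n)%N -> take m (mkseq f n) = mkseq f m.
Proof. by move=> mn; rewrite /mkseq -map_take take_iota (minn_idPl mn). Qed.

Section cantor_scheme.
Variables (R : realType) (X : completeMetricType R) (G : seq nat -> set X).
Hypothesis Gclosed : forall w, closed (G w).
Hypothesis Gsmall : forall x (e : R), 0 < e -> exists N, forall n,
  (N <= n)%N -> exists c, G (mkseq x n) `<=` ball c e.

Definition branches (w : seq nat) : set X :=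
  [set t | exists x, mkseq x (size w) = w /\ forall n, G (mkseq x n) t].

Definition uncountably_branching (w : seq nat) : Prop :=
  ~ countable (branches w).

Local Notation big := uncountably_branching.

(** Perfect-set argument: discarding the countable pieces removes countably many points, so two
    distinct points remain, and all words on their branches are still big. Long enough words
    separate them. *)
Lemma uncountably_branching_split w : big w ->
  exists v : seq nat * seq nat, [/\ big v.1, big v.2,
    take (size w) v.1 = w, take (size w) v.2 = w &
    [/\ (size w < size v.1)%N, (size w < size v.2)%N & G v.1 `&` G v.2 = set0]].
Proof.
move=> bw; pose small := \bigcup_(v in [set v | ~ big v]) branches v.
have csmall : countable small.
  by apply: bigcup_countable => // v /= /contrapT.
have [p [q [[wp np] [wq nq] pq]]] : exists p q,
    [/\ (branches w `\` small) p, (branches w `\` small) q & p <> q].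
  apply: contrapT => /forallNP npq; apply: bw.
  apply: (@sub_countable _ _ _
      (\bigcup_(b : bool) (if b then small else branches w `\` small))).
    apply: subset_card_le => x wx.
    by have [|] := pselect (small x); [exists true|exists false].
  apply: bigcup_countable => // -[//|] _.
  have [->|/set0P[p wp]] := eqVneq (branches w `\` small) set0.
    exact: countable0.
  apply: (@sub_countable _ _ _ [set p]); last exact: countable1.
  apply: subset_card_le => q wq /=; apply: contrapT => qp.
  by apply: (npq p); exists q; split => // pq; apply: qp.
have bigx r x : ~ small r -> (forall n, G (mkseq x n) r) ->
    forall n, big (mkseq x n).
  move=> nr Gr n cx; apply: nr; exists (mkseq x n); first by move=> /(_ cx).
  by exists x; rewrite size_mkseq.
case: wp => x [xw Gx]; case: wq => y [yw Gy].
(* If the two sets, each inside a ball of radius [e], met at [t], two steps shorter than [2e] would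
   join [p] to [q]. *)
pose e := mdist p q / 4.
have dpq : 0 < mdist p q by rewrite mdist_gt0; apply/eqP.
have e0 : 0 < e by rewrite divr_gt0.
have [N1 HN1] := Gsmall x e0; have [N2 HN2] := Gsmall y e0.
pose n := maxn (size w).+1 (maxn N1 N2).
have wn : (size w < n)%N by rewrite leq_max leqnn.
exists (mkseq x n, mkseq y n) => /=; split; first exact: (bigx p).
- exact: (bigx q).
- by rewrite take_mkseq// ltnW.
- by rewrite take_mkseq// ltnW.
split; rewrite ?size_mkseq// -subset0 => t [xt yt].
have [c1] := HN1 n ltac:(by rewrite !leq_max leqnn orbT).
have [c2] := HN2 n ltac:(by rewrite !leq_max leqnn !orbT).
move=> B2 B1.
have pt : ball p (e + e) t.
  by apply: ball_triangle (B1 _ xt); apply: ball_sym; exact: B1.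
have tq : ball t (e + e) q.
  by apply: ball_triangle (B2 _ (Gy n)); apply: ball_sym; exact: B2.
have := ball_triangle pt tq; rewrite ballEmdist /=.
suff -> : e + e + (e + e) = mdist p q by rewrite ltxx.
by rewrite /e; field.
Qed.

(** Iterated splitting gives a binary tree of big words. The words met along [z] strictly extend
    each other, so they determine a branch, and completeness puts a point on it. *)
Lemma cantor_scheme : big [::] -> exists (c : bool -> seq nat -> seq nat),
  forall z : nat -> bool, exists2 t, branches [::] t &
    forall n, let v := foldl (fun v b => c b v) [::] (mkseq z n) in
      G (c (z n) v) t /\ G (c true v) `&` G (c false v) = set0.
Proof.
move=> big0; have splitP w : exists v : seq nat * seq nat, big w ->
  [/\ big v.1, big v.2, take (size w) v.1 = w, take (size w) v.2 = w &
   [/\ (size w < size v.1)%N, (size w < size v.2)%N & G v.1 `&` G v.2 = set0]].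
  have [/uncountably_branching_split[v Hv]|nb] := pselect (big w).
    by exists v.
  by exists ([::], [::]).
have [f fP] := choice splitP.
pose c (b : bool) w := if b then (f w).1 else (f w).2.
have cP b w : big w ->
    [/\ big (c b w), take (size w) (c b w) = w & (size w < size (c b w))%N].
  by move=> /fP[? ? ? ? [? ? ?]]; rewrite /c; case: b.
exists c => z.
pose v n := foldl (fun v b => c b v) [::] (mkseq z n).
have vS n : v n.+1 = c (z n) (v n) by rewrite /v mkseqS foldl_rcons.
have bv n : big (v n).
  by elim: n => [//|n IH]; rewrite vS; case: (cP (z n) _ IH).
have ltv n : (size (v n) < size (v n.+1))%N.
  by rewrite vS; case: (cP (z n) _ (bv n)).
have takev n k : take (size (v n)) (v (n + k)%N) = v n.
  elim: k => [|k IH]; first by rewrite addn0 take_size.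
  have [_ + _] := cP (z (n + k)%N) _ (bv (n + k)%N).
  rewrite -vS -addnS => /(congr1 (take (size (v n)))).
  by rewrite IH take_takel// -{1}IH size_take; case: ifP => [/ltnW|].
have size_v n : (n <= size (v n))%N.
  by elim: n => [//|n IH]; exact: leq_ltn_trans IH (ltv n).
(* The word [v i.+1] has length at least [i.+1], so its letter [i] is a genuine one. *)
pose x i := nth 0%N (v i.+1) i.
have xv n : mkseq x (size (v n)) = v n.
  apply: (@eq_from_nth _ 0%N) => [|i]; rewrite size_mkseq// => iv.
  rewrite nth_mkseq// /x; have [le|/ltnW le] := leqP n i.+1.
    by rewrite -(subnKC le) -[in RHS](takev n (i.+1 - n)%N) nth_take.
  by rewrite -(subnKC le) -[in LHS](takev i.+1 (n - i.+1)%N) nth_take// (size_v i.+1).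
have [t Gt] : exists t, forall n, G (mkseq x n) t.
  apply: complete_bigcap => [n|e e0|n]; first exact: Gclosed.
  - by have [N /(_ N (leqnn N)) [a Ga]] := Gsmall x e0; exists N, a.
  - have [p [y [yv Gy]]] : branches (v n) !=set0.
      by apply/set0P/eqP => v0; apply: (bv n); rewrite v0; exact: countable0.
    exists p => m mn; have := Gy m.
    have ms : (m <= size (v n))%N by exact: leq_trans mn (size_v n).
    by rewrite -(take_mkseq y ms) yv -(xv n) take_mkseq.
exists t; first by exists x.
move=> n; split; first by have := Gt (size (v n.+1)); rewrite xv vS.
by rewrite /c; case: (fP _ (bv n)) => _ _ _ _ [].
Qed.

End cantor_scheme.

(** * Independent Borel sets in an uncountable Borel space *)

Section borel_independent.
Variables (R : realType) (X : completeMetricType R) (hX : separable X).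
Variable S : borelSubset X.

Lemma measurable_inclusion (C : set X) : closed C ->
  measurable (@inclusion _ S @^-1` C : set (borel S)).
Proof.
move=> cC; rewrite -[X in measurable X]setCK; apply: measurableC.
apply: sub_sigma_algebra; apply/open_subtypeP; exists (~` C) => //.
exact: closed_openC.
Qed.

(** A Borel coding of all 0-1 sequences by points. The point [t] walks down the Cantor scheme,
    turning to the true son whenever its set contains [t]; [W n t] is the node reached after [n]
    turns, and [P n] records turn [n]. Nodes are words, so [W n] has countably many values and is
    measurable. *)
Lemma uncountable_independent : ~ countable (carrier S) ->
  exists P : nat -> set (borel S), (forall n, measurable (P n)) /\
    forall z : nat -> bool, exists t, forall n, P n t <-> z n.
Proof.
move=> ucS; have [|G [cG Gsmall SE]] := borel_small_scheme hX _ (borel_carrier S).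
  by have [x _] := carrier_neq0 S; exists x.
have brE : branches G [::] = carrier S.
  rewrite SE; apply/seteqP; split => t [x]; first by move=> [_ ?]; exists x.
  by move=> Gx; exists x.
have [|c cP] := cantor_scheme cG Gsmall.
  by rewrite /uncountably_branching brE.
pose In w (t : borel S) := G w (inclusion t).
pose W n (t : borel S) : seq nat := iter n
  (fun w => if `[< In (c true w) t >] then c true w else c false w) [::].
have mIn w : measurable (In w : set (borel S)) by exact: measurable_inclusion.
have mW n w : measurable ([set t | W n t = w] : set (borel S)).
  elim: n w => [|n IH] w /=.
    have [->|w0] := pselect (w = [::]).
      by rewrite (_ : mkset _ = setT)//; apply/seteqP; split.
    by rewrite (_ : mkset _ = set0)//; apply/seteqP; split => // t /= /esym.
  rewrite (_ : mkset _ = \bigcup_(v : seq nat) ([set t | W n t = v] `&`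
    ((In (c true v) `&` [set t | c true v = w]) `|`
     (~` In (c true v) `&` [set t | c false v = w])))); last first.
    apply/seteqP; split => t /=.
      by case: asboolP => Hin Hw; exists (W n t) => //; split => //; [left|right].
    by move=> [v _ [<- []]] [Hin Hw]; case: asboolP.
  apply: countable_bigcupT_measurable => // v.
  have mcst (Q : Prop) : measurable ([set t | Q] : set (borel S)).
    have [q|nq] := pselect Q.
      by rewrite (_ : mkset _ = setT)//; apply/seteqP; split.
    by rewrite (_ : mkset _ = set0)//; apply/seteqP; split.
  apply: measurableI => //; apply: measurableU; apply: measurableI => //.
  exact: measurableC.
exists (fun n => [set t | In (c true (W n t)) t]); split.
  move=> n; rewrite (_ : mkset _ = \bigcup_(v : seq nat)
      ([set t | W n t = v] `&` In (c true v))).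
    by apply: countable_bigcupT_measurable => // v; exact: measurableI.
  apply/seteqP; split => t /=; first by exists (W n t).
  by move=> [v _ [<-]].
move=> z; have [t0 St0 tP] := cP z.
have St : carrier S t0 by rewrite -brE.
exists (to_subtype St) => n; set t := to_subtype St.
pose v n := foldl (fun v b => c b v) [::] (mkseq z n).
(* When [z m] is false the point lies in the set of the false son, and disjointness excludes the
   true one. *)
have inE m : In (c true (v m)) t <-> z m.
  have [zv vv] := tP m; rewrite -/(v m) in zv vv; split.
    move=> tv; apply: contraT => /negbTE zm; rewrite zm in zv.
    by have : set0 t0 by rewrite -vv.
  by move=> zm; rewrite zm in zv.
suff Wv m : W m t = v m by rewrite /= Wv.
elim: m => [//|m /= ->]; rewrite /v mkseqS foldl_rcons -/(v m).
case: asboolP => [/inE ->//|nv].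
by case zm: (z m) => //; case: nv; apply/inE.
Qed.

End borel_independent.

(** * Analytic subsets of a Borel space *)

Lemma continuous_borel (T U : topologicalType) (f : T -> U) (E : set U) :
  continuous f -> borel_set E -> borel_set (f @^-1` E).
Proof.
move=> cf; pose P := image_set_system [set: T] f (@borel_set T).
suff : @borel_set U `<=` P.
  by move=> h /h; rewrite /P /image_set_system /= setTI.
apply: smallest_sub.
  apply: sigma_algebra_image; exact: smallest_sigma_algebra.
move=> V oV; rewrite /P /image_set_system /= setTI; apply: sub_sigma_algebra.
by move/continuousP : cf; apply.
Qed.

Section suslin_analytic.
Variables (R : realType) (X : completeMetricType R) (hX : separable X).
Variable S : borelSubset X.

Lemma borel_fst_preimage (E : set S) : borel_set E ->
  borel_set [set st : S * S | E st.1].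
Proof. by apply: continuous_borel => st; exact: cvg_fst. Qed.

Lemma borel_snd_preimage (E : set S) : borel_set E ->
  borel_set [set st : S * S | E st.2].
Proof. by apply: continuous_borel => st; exact: cvg_snd. Qed.

Lemma borel_analytic (E : set S) : borel_set E -> analytic E.
Proof.
move=> bE; exists [set st | E st.1]; first exact: borel_fst_preimage.
apply/seteqP; split => s; first by move=> Es; exists (s, s).
by move=> [[s' t] /= Es <-].
Qed.

(** Singletons are closed, and each piece cut out by a value of the injection [f] has at most one
    point. *)
Lemma countable_borel (E : set S) : countable (carrier S) -> borel_set E.
Proof.
move=> /countable_injP[f f_inj].
have f_inclusion (s s' : S) : f (inclusion s) = f (inclusion s') -> s = s'.
  move=> /(f_inj _ _ (mem_set (inclusion_carrier s))
    (mem_set (inclusion_carrier s'))) ss'; rewrite -[s](inclusionK (inclusion_carrier s)).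
  rewrite -[s'](inclusionK (inclusion_carrier s')); exact: eq_sig_hprop.
rewrite (_ : E = \bigcup_n (E `&` [set s | f (inclusion s) = n])); last first.
  apply/seteqP; split => s; last by move=> [n _ []].
  by move=> Es; exists (f (inclusion s)).
apply: sigma_algebra_bigcup => n.
have [->|/set0P[s [Es sn]]] := eqVneq (E `&` [set s | f (inclusion s) = n]) set0.
  exact: sigma_algebra0.
rewrite (_ : _ `&` _ = @inclusion _ S @^-1` [set inclusion s]).
  apply: measurable_inclusion; apply: accessible_closed_set1.
  exact/hausdorff_accessible/metric_hausdorff.
apply/seteqP; split => s' /=.
  by move=> [_]; rewrite -sn => /f_inclusion ->.
by move=> /(congr1 f) fs; rewrite (f_inclusion _ _ fs).
Qed.

(** The second coordinate of [S * S] encodes the branch, by means of independent Borel sets. In the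
    countable case all sets are Borel. *)
Lemma suslin_analytic (E : set S) : suslin (@borel_set S) E -> analytic E.
Proof.
have [/countable_borel bS _|ucS] := pselect (countable (carrier S)).
  by apply: borel_analytic; exact: bS.
move=> [F bF ->]; have [P [mP indP]] := uncountable_independent hX ucS.
(* Letter [i] of a point is the first [k] with the point in [P (pickle (i, k))]. It is unique when
   it exists; a point may encode no branch. *)
pose letter (i k : nat) : set (borel S) :=
  P (pickle (i, k)) `&` \bigcap_(j in `I_k) ~` P (pickle (i, j)).
have letter_inj i k l t : letter i k t -> letter i l t -> k = l.
  move=> [Pk nk] [Pl nl]; apply/eqP; rewrite eqn_leq; apply/andP; split.
    by rewrite leqNgt; apply/negP => lk; exact: (nk _ lk).
  by rewrite leqNgt; apply/negP => kl; exact: (nl _ kl).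
have mletter i k : measurable (letter i k).
  apply: measurableI => //; apply: bigcap_measurableType => j _.
  exact: measurableC.
pose D : set (S * S) := \bigcap_n \bigcup_(w in [set w : seq nat | size w = n])
  ([set st | F w st.1] `&`
   [set st | (\bigcap_(i in `I_n) letter i (nth 0%N w i)) st.2]).
exists D.
  suff : measurable (D : set (borel (S * S)%type)) by [].
  apply: bigcapT_measurable => n.
  rewrite bigcup_mkcond; apply: countable_bigcupT_measurable => // w.
  case: ifP => // _; apply: measurableI.
    exact: borel_fst_preimage.
  apply: borel_snd_preimage.
  suff : measurable (\bigcap_(i in `I_n) letter i (nth 0%N w i)) by [].
  exact: bigcap_measurableType.
apply/seteqP; split => s /=.
- move=> [x Fx]; have [t tP] := indP (fun m =>
    oapp (fun ik : nat * nat => ik.2 == x ik.1) false (unpickle m)).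
  have letterx i : letter i (x i) t.
    split; first by apply/tP; rewrite pickleK /= eqxx.
    move=> j /= jx /tP; rewrite pickleK /= => /eqP jxE.
    by rewrite jxE ltnn in jx.
  exists (s, t) => // n _; exists (mkseq x n); first exact: size_mkseq.
  by split => //= i /= ni; rewrite nth_mkseq.
- move=> [[s0 t] Dst /= <-].
  have /choice[w wP] : forall n, exists w : seq nat, [/\ size w = n,
      F w s0 & forall i, (i < n)%N -> letter i (nth 0%N w i) t].
    by move=> n; have [w /= wn [Fw Lw]] := Dst n I; exists w.
  (* Letter [i] is read off the word of length [i.+1]; uniqueness of letters makes all the words
     agree with this branch. *)
  exists (fun i => nth 0%N (w i.+1) i) => n.
  have [wn Fw Lw] := wP n; rewrite (_ : mkseq _ n = w n)//.
  apply: (@eq_from_nth _ 0%N); rewrite size_mkseq// => i ni.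
  rewrite nth_mkseq//; have [_ _ Li] := wP i.+1.
  exact: letter_inj (Li i (ltnSn i)) (Lw i ni).
Qed.

End suslin_analytic.

(** * Outer measure of Souslin sets *)

Section outer_measure_finite.
Context d (T : measurableType d) (R : realType).
Variable mu : {measure set T -> \bar R}.
Hypothesis mu_fin : (mu setT < +oo)%E.

Lemma mu_ext_fin_num (E : set T) : (mu^*)%mu E \is a fin_num.
Proof.
rewrite ge0_fin_numE; last exact: mu_ext_ge0.
apply: le_lt_trans mu_fin; rewrite -measurable_mu_extE//.
exact: le_mu_ext.
Qed.

(** Intersect measurable covers whose measure exceeds the outer measure by at most 1/(n+1). *)
Lemma measurable_hull (E : set T) : exists A, [/\ measurable A, E `<=` A &
  mu A = (mu^*)%mu E].
Proof.
have muE := mu_ext_fin_num E.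
have cover n : exists A, [/\ measurable A, E `<=` A &
    (mu A <= (mu^*)%mu E + n.+1%:R^-1%:E)%E].
  have n0 : 0 < n.+1%:R^-1 :> R by [].
  have [_ [F [mF EF] <-] lt] := lb_ereal_inf_adherent n0 muE.
  exists (\bigcup_k F k); split => //; first exact: bigcupT_measurable.
  apply: le_trans (ltW lt); apply: measure_sigma_subadditive => //.
  exact: bigcupT_measurable.
have [A AP] := choice cover.
have mA : measurable (\bigcap_n A n).
  by apply: bigcapT_measurable => n; case: (AP n).
have EA : E `<=` \bigcap_n A n by move=> t Et n _; case: (AP n) => _ + _; apply.
exists (\bigcap_n A n); split => //; apply/eqP; rewrite eq_le; apply/andP; split.
  rewrite -(fineK muE); apply/lee_addgt0Pr => e e0.
  have [n] := ltr_add_invr e0; rewrite add0r => ne.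
  apply: (@le_trans _ _ (mu (A n))).
    apply: le_measure; rewrite ?inE//; first by case: (AP n).
    exact: bigcap_inf.
  case: (AP n) => _ _ /le_trans; apply; rewrite fineK// leeD2l//.
  by rewrite lee_fin ltW.
by rewrite -measurable_mu_extE//; exact: le_mu_ext.
Qed.

(** Continuity of the outer measure from below. The intersection [B n] of the hulls from rank [n] on
    is increasing, contains [E n] and is no larger than the hull of [E n], so continuity of [mu]
    applies to it. *)
Lemma mu_ext_bigcup_gt (E : nat -> set T) (c : \bar R) :
  nondecreasing_seq E -> (c < (mu^*)%mu (\bigcup_n E n))%E ->
  exists n, (c < (mu^*)%mu (E n))%E.
Proof.
move=> ndE cE; apply: contrapT => /forallNP nE.
have [A AP] := choice (fun n => measurable_hull (E n)).
pose B n := \bigcap_(m in [set m | (n <= m)%N]) A m.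
have mB n : measurable (B n).
  by apply: bigcap_measurableType => m _; case: (AP m).
have EB n : E n `<=` B n.
  move=> t Et m /= nm; case: (AP m) => _ + _; apply.
  by have /subsetPset := ndE _ _ nm; apply.
have ndB : nondecreasing_seq B.
  move=> m n mn; apply/subsetPset => t Bt k /= nk; apply: Bt => /=.
  exact: leq_trans mn nk.
have mUB : measurable (\bigcup_n B n) by exact: bigcupT_measurable.
move: cE; rewrite ltNge => /negP; apply.
apply: (@le_trans _ _ (mu (\bigcup_n B n))).
  rewrite -measurable_mu_extE//; apply: le_mu_ext.
  by apply: subset_bigcup => n _; exact: EB.
rewrite -(cvg_lim _ (nondecreasing_cvg_mu mB mUB ndB))//.
apply: lime_le; first by apply/cvg_ex; eexists; exact: nondecreasing_cvg_mu.
apply: nearW => n /=; have /negP := nE n; rewrite -leNgt.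
apply: le_trans; have [mA _ <-] := AP n.
apply: le_measure; rewrite ?inE// => t; apply; exact: leqnn.
Qed.

End outer_measure_finite.

(** * Approximation and completed measurability of Souslin sets *)

Section suslin_measurable.
Context d (T : measurableType d).
Variable F : seq nat -> set T.
Hypothesis mF : forall w, measurable (F w).

Let E := [set t | exists x : nat -> nat, forall n, F (mkseq x n) t].

Definition bounded_branch (v : seq nat) (x : nat -> nat) :=
  forall i, (i < size v)%N -> (x i <= nth 0 v i)%N.

Definition bounded_kernel (v : seq nat) : set T :=
  [set t | exists x, bounded_branch v x /\ forall n, F (mkseq x n) t].

(** Only the conditions up to the length of [v] are kept: a measurable set containing
    [bounded_kernel v], which may fail to be measurable itself. *)
Definition bounded_trunc (v : seq nat) : set T :=
  [set t | exists x, bounded_branch v x /\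
    forall n, (n <= size v)%N -> F (mkseq x n) t].

Lemma bounded_kernel_sub_trunc v : bounded_kernel v `<=` bounded_trunc v.
Proof. by move=> t [x [xv Fx]]; exists x. Qed.

(** Only the first [size v] letters matter, so branches may be replaced by words continued with
    zeros, and there are countably many words. *)
Lemma measurable_bounded_trunc v : measurable (bounded_trunc v).
Proof.
rewrite (_ : bounded_trunc v = \bigcup_(w : seq nat)
    (if `[< bounded_branch v (nth 0%N w) >] then
      \bigcap_(n in [set n | (n <= size v)%N]) F (mkseq (nth 0%N w) n)
     else set0)).
  apply: countable_bigcupT_measurable => // w; case: asboolP => // _.
  exact: bigcap_measurableType.
apply/seteqP; split => t.
- move=> [x [xv Fx]]; exists (mkseq x (size v)) => //.
  have xE i : (i < size v)%N -> nth 0%N (mkseq x (size v)) i = x i.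
    exact: nth_mkseq.
  rewrite asboolT; last by move=> i iv; rewrite xE// xv.
  move=> n /= nv; rewrite (@eq_mkseq_lt _ _ x)//; first exact: Fx.
  by move=> i ni; rewrite xE// (leq_trans ni).
- by move=> [w _]; case: asboolP => // wv Fw; exists (nth 0%N w).
Qed.

Lemma bounded_kernel_nil : bounded_kernel [::] = E.
Proof. by apply/seteqP; split => t [x]; [move=> []|]; exists x. Qed.

Lemma bounded_kernel_rcons v :
  bounded_kernel v = \bigcup_k bounded_kernel (rcons v k).
Proof.
apply/seteqP; split => t.
- move=> [x [xv Fx]]; exists (x (size v)) => //; exists x; split => // i.
  rewrite size_rcons ltnS leq_eqVlt => /orP[/eqP ->|iv].
    by rewrite nth_rcons ltnn eqxx.
  by rewrite nth_rcons iv; exact: xv.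
- move=> [k _ [x [xv Fx]]]; exists x; split => // i iv.
  by have := xv i; rewrite size_rcons nth_rcons iv; apply; exact: ltnW.
Qed.

Lemma nondecreasing_bounded_kernel v :
  nondecreasing_seq (fun k => bounded_kernel (rcons v k)).
Proof.
move=> k l kl; apply/subsetPset => t [x [xv Fx]]; exists x; split => // i.
rewrite size_rcons => iv; have := xv i; rewrite size_rcons => /(_ iv).
rewrite !nth_rcons; case: ifP => // _; case: ifP => // _ /leq_trans; exact.
Qed.

Lemma nonincreasing_bounded_trunc y :
  nonincreasing_seq (fun n => bounded_trunc (mkseq y n)).
Proof.
move=> m n mn; apply/subsetPset => t [x []].
rewrite /bounded_branch size_mkseq => xy Fx.
exists x; rewrite /bounded_branch size_mkseq; split.
- move=> i im; have := xy i (leq_trans im mn).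
  by rewrite !nth_mkseq// (leq_trans im).
- by move=> k km; apply: Fx; exact: leq_trans km mn.
Qed.

(* Koenig's lemma for the finitely branching tree of the words bounded by [y]. *)
Lemma bigcap_bounded_trunc y : \bigcap_n bounded_trunc (mkseq y n) `<=` E.
Proof.
move=> t Ty.
have trunc n : exists x, (forall i, (i < n)%N -> (x i <= y i)%N) /\
    forall m, (m <= n)%N -> F (mkseq x m) t.
  have [x] := Ty n I; rewrite /bounded_branch size_mkseq => -[xy Fx].
  by exists x; split => // i ni; have := xy i ni; rewrite nth_mkseq.
pose extends w n x := [/\ mkseq x (size w) = w,
  forall i, (i < n)%N -> (x i <= y i)%N &
  forall m, (m <= n)%N -> F (mkseq x m) t].
pose alive w := forall n, (size w <= n)%N -> exists x, extends w n x.
have alive0 : alive [::].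
  by move=> n _; have [x [xy Fx]] := trunc n; exists x.
have aliveS w : exists k, alive w -> alive (rcons w k).
  have [aw|] := pselect (alive w); last by exists 0%N.
  apply: contrapT => /forallNP nk.
  have /choice[N NP] : forall k, exists N, (size w < N)%N /\
      forall x, ~ extends (rcons w k) N x.
    move=> k; have := nk k => /not_implyP[_] /existsNP[N].
    by move=> /not_implyP[]; rewrite size_rcons => wN /forallNP NP; exists N.
  (* All the admissible next letters, finitely many, fail by level [M], whereas [aw M] reaches level
     [M] through one of them. *)
  pose M := maxn (size w).+1 (\max_(k < (y (size w)).+1) N k).
  have [|x [xw xy Fx]] := aw M; first by rewrite leq_max leqnSn.
  have xk : (x (size w) < (y (size w)).+1)%N by rewrite ltnS xy// leq_max leqnn.
  have NM : (N (x (size w)) <= M)%N.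
    by rewrite leq_max (leq_bigmax (Ordinal xk)) orbT.
  have [_ /(_ x)] := NP (x (size w)); apply; split.
  - by rewrite size_rcons mkseqS xw.
  - by move=> i iN; apply: xy; exact: leq_trans iN NM.
  - by move=> m mN; apply: Fx; exact: leq_trans mN NM.
have [g gP] := choice aliveS.
pose w n := iter n (fun w => rcons w (g w)) [::].
have aw n : alive (w n) by elim: n => [//|n IH]; exact: gP.
have wE n : mkseq (g \o w) n = w n by elim: n => [//|n IH]; rewrite mkseqS IH.
exists (g \o w) => n; have [x [+ _ Fx]] := aw n (size (w n)) (leqnn _).
by rewrite wE => <-; apply: Fx.
Qed.

Variables (R : realType) (mu : {measure set T -> \bar R}).
Hypothesis mu_fin : (mu setT < +oo)%E.

(** Bounds are chosen one letter at a time: continuity from below keeps the outer measure of the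
    bounded kernel above [c], and the truncation contains that kernel. *)
Lemma bounded_trunc_gt (c : \bar R) : (c < (mu^*)%mu E)%E ->
  exists y, forall n, (c < mu (bounded_trunc (mkseq y n)))%E.
Proof.
move=> cE.
have next v : exists k, (c < (mu^*)%mu (bounded_kernel v))%E ->
    (c < (mu^*)%mu (bounded_kernel (rcons v k)))%E.
  have [cv|] := pselect (c < (mu^*)%mu (bounded_kernel v))%E; last by exists 0%N.
  have [|k ck] := mu_ext_bigcup_gt mu_fin (@nondecreasing_bounded_kernel v)
    (c := c).
    by rewrite -bounded_kernel_rcons.
  by exists k.
have [g gP] := choice next.
pose w n := iter n (fun w => rcons w (g w)) [::].
have cw n : (c < (mu^*)%mu (bounded_kernel (w n)))%E.
  by elim: n => [|n IH]; [rewrite bounded_kernel_nil|exact: gP].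
have wE n : mkseq (g \o w) n = w n by elim: n => [//|n IH]; rewrite mkseqS IH.
exists (g \o w) => n; rewrite wE; apply: lt_le_trans (cw n) _.
rewrite -measurable_mu_extE; last exact: measurable_bounded_trunc.
by apply: le_mu_ext; exact: bounded_kernel_sub_trunc.
Qed.

(** The truncations decrease to a measurable subset of [E], and a finite measure is continuous from
    above. *)
Lemma bounded_trunc_ge (c : \bar R) y :
  (forall n, (c <= mu (bounded_trunc (mkseq y n)))%E) ->
  exists M, [/\ measurable M, M `<=` E & (c <= mu M)%E].
Proof.
move=> cy; exists (\bigcap_n bounded_trunc (mkseq y n)).
have mM : measurable (\bigcap_n bounded_trunc (mkseq y n)).
  by apply: bigcapT_measurable => n; exact: measurable_bounded_trunc.
split => //; first exact: bigcap_bounded_trunc.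
have cvg : mu (bounded_trunc (mkseq y n)) @[n --> \oo] -->
    mu (\bigcap_n bounded_trunc (mkseq y n)).
  apply: nonincreasing_cvg_mu => //.
  - apply: le_lt_trans mu_fin; apply: le_measure; rewrite ?inE//.
    exact: measurable_bounded_trunc.
  - by move=> n; exact: measurable_bounded_trunc.
  - exact: nonincreasing_bounded_trunc.
rewrite -(cvg_lim _ cvg)//; apply: lime_ge; first by apply/cvg_ex; eexists; exact: cvg.
exact: nearW.
Qed.

(** The margin 1/(j+1) keeps the inequality strict in the limit. The right-hand side involves only
    measures of measurable sets, so it can be followed along a kernel. *)
Lemma suslin_mu_ext_gtP (c : R) : (c%:E < (mu^*)%mu E)%E <->
  exists j y, forall n,
    ((c + j.+1%:R^-1)%:E <= mu (bounded_trunc (mkseq y n)))%E.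
Proof.
split.
- move=> cE; have Efin := mu_ext_fin_num mu_fin E.
  move: (cE); rewrite -(fineK Efin) lte_fin => /ltr_add_invr[j].
  rewrite -lte_fin fineK// => /bounded_trunc_gt[y yP].
  by exists j, y => n; exact: ltW.
- move=> [j [y /bounded_trunc_ge[M [mM ME cM]]]].
  apply: (@lt_le_trans _ _ (mu M)).
    by apply: lt_le_trans cM; rewrite lte_fin ltrDl.
  by rewrite -measurable_mu_extE//; exact: le_mu_ext.
Qed.

(** [E] lies between a countable union of inner approximations and its measurable hull, of equal
    measure; what remains is a subset of a null set. *)
Lemma suslin_caratheodory : (mu^*)%mu.-cara.-measurable E.
Proof.
have Efin := mu_ext_fin_num mu_fin E.
have inner j : exists M, [/\ measurable M, M `<=` E &
    ((mu^*)%mu E - j.+1%:R^-1%:E <= mu M)%E].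
  have : ((mu^*)%mu E - j.+1%:R^-1%:E < (mu^*)%mu E)%E.
    by rewrite -(fineK Efin) -EFinB lte_fin ltrBlDr ltrDl.
  by move=> /bounded_trunc_gt[y yP]; apply: (@bounded_trunc_ge _ y) => n; exact: ltW.
have [M MP] := choice inner.
have [A [mA EA muA]] := measurable_hull mu_fin E.
have mUM : measurable (\bigcup_j M j).
  by apply: bigcupT_measurable => j; case: (MP j).
have ME : \bigcup_j M j `<=` E by move=> t [j _]; case: (MP j) => _ + _; apply.
have muM : mu (\bigcup_j M j) = (mu^*)%mu E.
  apply/eqP; rewrite eq_le; apply/andP; split.
    by rewrite -measurable_mu_extE//; exact: le_mu_ext.
  rewrite -(fineK Efin); apply/lee_subgt0Pr => e e0.
  have [j] := ltr_add_invr e0; rewrite add0r => je.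
  apply: (@le_trans _ _ (mu (M j))).
    have [_ _] := MP j; apply: le_trans; rewrite fineK// leeB//.
    by rewrite lee_fin ltW.
  apply: le_measure; rewrite ?inE//; first by case: (MP j).
  exact: bigcup_sup.
rewrite -(setDKU ME); apply: measurableU; last exact: caratheodory_measurable_mu_ext.
apply: measure_is_complete_caratheodory; exists (A `\` \bigcup_j M j); split.
- by apply: caratheodory_measurable_mu_ext; exact: measurableD.
- rewrite /= measurable_mu_extE; last exact: measurableD.
  transitivity (mu A - mu (A `&` \bigcup_j M j))%E.
    rewrite measureD//.
    by apply: le_lt_trans mu_fin; apply: le_measure; rewrite ?inE.
  rewrite (setIidr (subset_trans ME EA)) muA muM subee//.
- by move=> t [Et nM]; split => //; exact: EA.
Qed.

End suslin_measurable.

(** * Upper semianalytic integrands *)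

Section upper_suslin.
Variables (T : Type) (R : realType) (H : set (set T)).
Hypotheses (HT : H setT) (H0 : H set0).

(** The form of upper semianalyticity carried through the proof; [suslin_analytic] converts it back
    on [S]. *)
Definition upper_suslin (f : T -> R) : Prop :=
  forall c : R, suslin H [set t | c < f t].

Lemma upper_suslin_cst (c : R) : upper_suslin (fun=> c).
Proof.
move=> c'; apply: sub_suslin; have [cc'|c'c] := boolP (c' < c).
  by rewrite (_ : mkset _ = setT)//; apply/seteqP; split.
by rewrite (_ : mkset _ = set0)//; apply/seteqP; split.
Qed.

(** A rational is inserted between [c - g t] and [f t]. *)
Lemma upper_suslinD f g : upper_suslin f -> upper_suslin g ->
  upper_suslin (fun t => f t + g t).
Proof.
move=> sf sg c.
rewrite (_ : mkset _ = \bigcup_(a : rat) ([set t | ratr a < f t] `&`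
    [set t | c - ratr a < g t])).
  by apply: suslin_bigcup_countable => // a _; exact: suslinI.
apply/seteqP; split => t /=.
  rewrite -ltrBlDr => /rat_in_itvoo[a]; rewrite in_itv/= => /andP[ca af].
  by exists a => //; split => //=; rewrite ltrBlDr addrC -ltrBlDr.
move=> [a _ /= [af cg]]; rewrite -(subrK (ratr a) c) addrC.
exact: ltrD.
Qed.

Lemma upper_suslinZ (e : R) f : 0 < e -> upper_suslin f ->
  upper_suslin (fun t => e * f t).
Proof.
move=> e0 sf c; rewrite (_ : mkset _ = [set t | c / e < f t])//.
by apply/seteqP; split => t /=; rewrite ltr_pdivrMr// mulrC.
Qed.

Lemma upper_suslin_sum (n : nat) (f : 'I_n -> T -> R) :
  (forall i, upper_suslin (f i)) -> upper_suslin (fun t => \sum_i f i t).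
Proof.
elim: n f => [|n IH] f sf.
  rewrite (_ : (fun _ => _) = fun=> 0); first exact: upper_suslin_cst.
  by apply/funext => t; rewrite big_ord0.
rewrite (_ : (fun _ => _) =
    fun t => f ord0 t + \sum_i f (lift ord0 i) t).
  by apply: upper_suslinD => //; exact: IH.
by apply/funext => t; rewrite big_ord_recl.
Qed.

End upper_suslin.

(** * Layer sums approximating a nonnegative number *)

Section layers.
Variable R : realType.

(** The sum is [e] times the number of the first [n] positive multiples of [e] that are below [x];
    the induction removes one layer and passes to [x - e]. *)
Lemma layers_bounds (e : R) (n : nat) (x : R) : 0 < e -> 0 <= x ->
  \sum_(i < n) e * (i.+1%:R * e < x)%R%:R <= x /\
  (x <= n%:R * e -> x - e <= \sum_(i < n) e * (i.+1%:R * e < x)%R%:R).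
Proof.
move=> e0; elim: n x => [|n IH] x x0.
  rewrite big_ord0 mul0r; split => // x0'.
  by rewrite subr_le0 (le_trans x0')// ltW.
rewrite big_ord_recl/= mul1r; have [ex|xe] := ltP e x.
  have [IH1 IH2] := IH (x - e) ltac:(by rewrite subr_ge0 ltW).
  have -> : \sum_(i < n) e * ((bump 0 i).+1%:R * e < x)%R%:R =
            \sum_(i < n) e * (i.+1%:R * e < x - e)%R%:R.
    apply: eq_bigr => i _; rewrite /bump/= add1n ltrBrDr.
    by rewrite -[in i.+2%:R]addn1 natrD mulrDl mul1r.
  rewrite mulr1; split; first by rewrite addrC -lerBrDr.
  move=> xn; rewrite [leRHS]addrC -lerBlDr; apply: IH2.
  by rewrite lerBlDr (le_trans xn)// -addn1 natrD mulrDl mul1r.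
rewrite mulr0 add0r big1.
  by split => // _; rewrite subr_le0.
move=> i _; rewrite (_ : _ < x = false) ?mulr0//; apply/negbTE.
by rewrite -leNgt (le_trans xe)// ler_peMl ?ler1n// ltW.
Qed.

End layers.

(** * Integrals with respect to the completed measure *)

Section completed_integral_suslin.
Context d (T : measurableType d) (R : realType).
Implicit Types (mu : {measure set T -> \bar R}) (f : T -> R).

Lemma suslin_cara mu (E : set T) : (mu setT < +oo)%E ->
  suslin d.-measurable E -> (mu^*)%mu.-cara.-measurable E.
Proof. by move=> mu_fin [F mF ->]; exact: suslin_caratheodory. Qed.

Lemma upper_suslin_measurable mu f : (mu setT < +oo)%E ->
  upper_suslin d.-measurable f ->
  measurable_fun [set: caratheodory_type (mu^*)%mu] f.
Proof.
move=> mu_fin sf; apply: (measurability _ (RGenOInfty.measurableE R)).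
move=> _ [_ [c ->] <-]; rewrite setTI.
rewrite (_ : _ @^-1` _ = [set t | c < f t]).
  exact: suslin_cara.
by apply/seteqP; split => t /=; rewrite in_itv/= andbT.
Qed.

Variable mu : {measure set T -> \bar R}.
Hypothesis mu1 : mu setT = 1%E.

Let mu_fin : (mu setT < +oo)%E. Proof. by rewrite mu1 ltry. Qed.

Let cmu := @completed_measure_extension _ _ _ mu.

Lemma completed_measureT : cmu setT = 1%E.
Proof. by rewrite -mu1; exact: measurable_mu_extE. Qed.

Lemma completed_integral_cst (c : R) : completed_integral mu (fun=> c) = c%:E.
Proof.
rewrite /completed_integral integral_cst// -[RHS]mule1; congr (_ * _)%E.
exact: completed_measureT.
Qed.

Variable f : T -> R.
Hypotheses (sf : upper_suslin d.-measurable f) (f01 : forall t, 0 <= f t <= 1).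

Let mf := upper_suslin_measurable mu_fin sf.

(** Layer-cake approximation: up to [e], the integral is a finite sum of outer measures of
    superlevel sets, which are Souslin. *)
Lemma completed_integral_layers (n : nat) :
  let e : R := n.+1%:R^-1 in
  let s : R := \sum_(i < n.+1) e * fine ((mu^*)%mu [set t | i.+1%:R * e < f t]) in
  (s%:E <= completed_integral mu f)%E /\
  (completed_integral mu f <= (s + e)%:E)%E.
Proof.
move=> e s.
have e0 : 0 < e by rewrite invr_gt0.
pose E (i : 'I_n.+1) := [set t | i.+1%:R * e < f t].
pose layer (t : T) : R := \sum_(i < n.+1) e * (i.+1%:R * e < f t)%R%:R.
have layerE t : layer t = \sum_(i < n.+1) e * \1_(E i) t.
  apply: eq_bigr => i _; rewrite indicE; congr (_ * (nat_of_bool _)%:R).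
  apply/idP/idP => [Et|/set_mem Et].
    exact: mem_set.
  by [].
have mE i : (mu^*)%mu.-cara.-measurable (E i) by apply: suslin_cara => //; exact: sf.
have mindic i : measurable_fun [set: caratheodory_type (mu^*)%mu]
    (\1_(E i) : _ -> R).
  exact: (measurable_indic (T := caratheodory_type (mu^*)%mu) (mE i)).
have mind i : measurable_fun [set: caratheodory_type (mu^*)%mu]
    (fun t => (e * \1_(E i) t : R)%:E).
  by apply/measurable_EFinP; apply: measurable_funM.
have int_layer : completed_integral mu layer = s%:E.
  rewrite /completed_integral.
  under eq_integral do rewrite layerE -sumEFin.
  rewrite ge0_integral_sum//; last first.
    by move=> i t _; rewrite lee_fin mulr_ge0// ltW.
  rewrite -sumEFin; apply: eq_bigr => i _.
  under eq_integral do rewrite EFinM.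
  rewrite ge0_integralZl; last 4 first.
  - exact: measurableT.
  - exact/measurable_EFinP.
  - by move=> t _; rewrite lee_fin.
  - by rewrite lee_fin ltW.
  rewrite integral_indic// setIT EFinM fineK//.
  exact: mu_ext_fin_num.
have mlayer : measurable_fun [set: caratheodory_type (mu^*)%mu]
    (fun t => (layer t)%:E).
  rewrite (_ : (fun _ => _) = fun t => \sum_(i < n.+1) (e * \1_(E i) t)%:E)%E.
    exact: emeasurable_sum.
  by apply/funext => t; rewrite layerE sumEFin.
have layer_ge0 t : 0 <= layer t.
  by apply: sumr_ge0 => i _; rewrite mulr_ge0// ltW.
have layerP t : layer t <= f t <= layer t + e.
  have /andP[f0 f1] := f01 t.
  have [le1 le2] := layers_bounds n.+1 e0 f0.
  rewrite le1/= -lerBlDr le2//.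
  (* The [n.+1] layers of height [e] reach exactly 1, the upper bound of [f]. *)
  by rewrite /e divff// pnatr_eq0.
have mf' : measurable_fun [set: caratheodory_type (mu^*)%mu] (EFin \o f).
  exact/measurable_EFinP.
split.
  rewrite -int_layer; apply: ge0_le_integral => //.
  - by move=> t _; rewrite lee_fin; case/andP: (f01 t).
  - by move=> t _; rewrite lee_fin; case/andP: (layerP t).
rewrite EFinD -int_layer -[e%:E]completed_integral_cst /completed_integral.
rewrite -ge0_integralD//; last 2 first.
- by move=> t _; rewrite lee_fin.
- by move=> t _; rewrite lee_fin ltW.
apply: ge0_le_integral; first exact: measurableT.
- by move=> t _; rewrite lee_fin; case/andP: (f01 t).
- exact: mf'.
- by apply: emeasurable_funD => //; exact: measurable_cst.
- by move=> t _; rewrite -EFinD lee_fin; case/andP: (layerP t).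
Qed.

Lemma completed_integral_fin_num : completed_integral mu f \is a fin_num.
Proof.
have [lo hi] := completed_integral_layers 0.
apply/fin_real; rewrite (lt_le_trans _ lo) ?ltNyr//=.
exact: le_lt_trans hi (ltry _).
Qed.

End completed_integral_suslin.

(** * Dependence on the parameter of a kernel *)

Section kernel_suslin.
Context d d' (X : measurableType d) (T : measurableType d') (R : realType).
Variable q : R.-pker X ~> T.

Lemma kernelT k : q k setT = 1%E.
Proof. exact: prob_kernel. Qed.

Lemma kernel_fin k : (q k setT < +oo)%E.
Proof. by rewrite kernelT ltry. Qed.

(** In [suslin_mu_ext_gtP] each condition is measurable in [k], so the criterion is itself a Souslin
    scheme: [z None] is the margin index, the other letters are the bounding branch. *)
Lemma suslin_kernel_gt (E : set T) (c : R) : suslin d'.-measurable E ->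
  suslin d.-measurable [set k | (c%:E < ((q k)^*)%mu E)%E].
Proof.
move=> [F mF ->].
rewrite (_ : mkset _ = [set k | exists z : option nat -> nat, forall n,
    ((c + (z None).+1%:R^-1)%:E <=
      q k (bounded_trunc F (mkseq (z \o Some) n)))%E]).
  apply: suslin_finitely_determined => // [n|n z].
    exists (None :: map Some (iota 0 n)) => z z' zz'.
    rewrite zz' ?mem_head// (@eq_mkseq_lt _ _ (z' \o Some))// => i ni /=.
    by apply: zz'; rewrite inE map_f// mem_iota.
  rewrite -[X in measurable X]setTI.
  apply: emeasurable_fun_c_infty => //.
  by apply: measurable_kernel; exact: measurable_bounded_trunc.
apply/seteqP; split => k /=.
- move/(suslin_mu_ext_gtP mF (kernel_fin k)) => [j [y yP]].
  by exists (oapp y j) => n; exact: yP.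
- move=> [z zP]; apply/(suslin_mu_ext_gtP mF (kernel_fin k)).
  by exists (z None), (z \o Some).
Qed.

(** Layer sums approach the integral from below within 1/(n+1), so its superlevel set is the union
    of theirs. *)
Lemma upper_suslin_integral (f : T -> R) : (forall t, 0 <= f t <= 1) ->
  upper_suslin d'.-measurable f ->
  upper_suslin d.-measurable (fun k => fine (completed_integral (q k) f)).
Proof.
move=> f01 sf c.
pose layers n k : R := \sum_(i < n.+1) n.+1%:R^-1 *
  fine (((q k)^*)%mu [set t | i.+1%:R * n.+1%:R^-1 < f t]).
have slayers n : upper_suslin d.-measurable (layers n).
  apply: upper_suslin_sum => // i; apply: upper_suslinZ => // a.
  rewrite (_ : mkset _ = [set k |
      (a%:E < ((q k)^*)%mu [set t | (i.+1%:R * n.+1%:R^-1 < f t)%R])%E]).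
    by apply: suslin_kernel_gt; exact: sf.
  apply/seteqP; split => k /=;
    by rewrite -lte_fin fineK//; exact: mu_ext_fin_num (kernel_fin k) _.
rewrite (_ : mkset _ = \bigcup_n [set k | c < layers n k]).
  by apply: suslin_bigcup => // n; exact: slayers.
have layersP n k : layers n k <= fine (completed_integral (q k) f) <=
    layers n k + n.+1%:R^-1.
  have [] := completed_integral_layers (kernelT k) sf f01 n.
  by rewrite -(fineK (completed_integral_fin_num (kernelT k) sf f01))
    !lee_fin => -> ->.
apply/seteqP; split => k /=.
- move=> /ltr_add_invr[n cn]; exists n => //=.
  by have /andP[_ /(lt_le_trans cn)] := layersP n k; rewrite ltrD2r.
- by move=> [n _ /= cn]; have /andP[/(lt_le_trans cn)] := layersP n k.
Qed.

End kernel_suslin.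

(** * Power means *)

Section power_mean.
Variable R : realType.
Implicit Types x y u w a p beta : R.

Lemma le0_ger_powR a x y : a <= 0 -> 0 < x -> x <= y -> y `^ a <= x `^ a.
Proof.
move=> a0 x0 xy; have y0 := lt_le_trans x0 xy.
rewrite -(opprK a) ![_ `^ (- - a)]powRN lef_pV2 ?posrE ?powR_gt0//.
by apply: ge0_ler_powR; rewrite ?nnegrE ?oppr_ge0// ltW.
Qed.

Lemma powR_continuous a x : 0 < x -> {for x, continuous (@powR R ^~ a)}.
Proof.
move=> x0; apply: differentiable_continuous; apply/derivable1_diffP.
by case: (is_derive1_powR a x0).
Qed.

Definition power_mean beta p u w := ((1 - beta) * u `^ p + beta * w `^ p) `^ p^-1.

Variables (beta p : R).
Hypotheses (beta01 : 0 <= beta < 1) (p0 : p != 0).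

Local Notation mean := (power_mean beta p).

Let beta_ge0 : 0 <= beta. Proof. by case/andP: beta01. Qed.
Let obeta_gt0 : 0 < 1 - beta. Proof. by rewrite subr_gt0; case/andP: beta01. Qed.

Let mean_base_gt0 u w : 0 < u -> 0 < (1 - beta) * u `^ p + beta * w `^ p.
Proof.
by move=> u0; rewrite ltr_pwDl// ?mulr_gt0 ?powR_gt0// mulr_ge0// powR_ge0.
Qed.

Lemma power_mean_diag x : 0 < x -> mean x x = x.
Proof.
by move=> x0; rewrite /power_mean -mulrDl subrK mul1r -powRrM mulfV// powRr1// ltW.
Qed.

(** For negative [p] the inner powers and the outer root both reverse the order. *)
Lemma le_power_mean u u' w w' : 0 < u -> u <= u' -> 0 < w -> w <= w' ->
  mean u w <= mean u' w'.
Proof.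
move=> u0 uu' w0 ww'; have u'0 := lt_le_trans u0 uu'.
have w'0 := lt_le_trans w0 ww'; rewrite /power_mean; move: p0; rewrite neq_lt => /orP[pn|pp].
  apply: le0_ger_powR; [by rewrite invr_le0 ltW|exact: mean_base_gt0|].
  by apply: lerD; rewrite ler_wpM2l// ?(ltW obeta_gt0)// le0_ger_powR// ltW.
apply: ge0_ler_powR; rewrite ?nnegrE ?invr_ge0 ?(ltW pp) ?(ltW (mean_base_gt0 _ _))//.
apply: lerD; rewrite ler_wpM2l// ?(ltW obeta_gt0)//;
  by apply: ge0_ler_powR; rewrite ?nnegrE// ltW.
Qed.

Let scale_mean u : 0 < u ->
  ((1 - beta) * u `^ p) `^ p^-1 = (1 - beta) `^ p^-1 * u.
Proof.
move=> u0; rewrite powRM ?(ltW obeta_gt0) ?powR_ge0//.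
by rewrite -powRrM mulfV// powRr1// ltW.
Qed.

Let base_ge u w : (1 - beta) * u `^ p <= (1 - beta) * u `^ p + beta * w `^ p.
Proof. by rewrite lerDl mulr_ge0// powR_ge0. Qed.

Lemma power_mean_le u w : p < 0 -> 0 < u -> mean u w <= (1 - beta) `^ p^-1 * u.
Proof.
move=> pn u0; rewrite -scale_mean//; apply: le0_ger_powR => //.
  by rewrite invr_le0 ltW.
by rewrite mulr_gt0// powR_gt0.
Qed.

Lemma power_mean_ge u w : 0 < p -> 0 < u -> (1 - beta) `^ p^-1 * u <= mean u w.
Proof.
move=> pp u0; rewrite -scale_mean//; apply: ge0_ler_powR => //.
- by rewrite invr_ge0 ltW.
- by rewrite nnegrE mulr_ge0 ?powR_ge0// ltW.
- by rewrite nnegrE ltW// mean_base_gt0.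
Qed.

(** One bound compares with the mean on the diagonal, at [eps] or [B]; the other drops the term in
    [w]. The sign of [p] decides which is which. *)
Lemma power_mean_bounds b0 b1 eps B u w : 0 < eps -> 0 < b0 ->
  (p < 0 -> eps <= b0 /\ (1 - beta) `^ p^-1 * b1 <= B) ->
  (0 < p -> eps <= (1 - beta) `^ p^-1 * b0 /\ b1 <= B) ->
  b0 <= u <= b1 -> eps <= w <= B -> eps <= mean u w <= B.
Proof.
move=> eps0 b00 hneg hpos /andP[b0u ub1] /andP[epsw wB].
have u0 := lt_le_trans b00 b0u; have w0 := lt_le_trans eps0 epsw.
have c0 : 0 <= (1 - beta) `^ p^-1 by exact: powR_ge0.
have B0 : 0 < B := lt_le_trans w0 wB.
move: p0; rewrite neq_lt => /orP[pn|pp].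
  have [epsb0 b1B] := hneg pn; apply/andP; split.
    apply: (@le_trans _ _ (mean eps eps)); first by rewrite power_mean_diag.
    apply: le_power_mean => //.
    exact: le_trans epsb0 b0u.
  apply: le_trans (power_mean_le _ pn u0) _; apply: le_trans b1B.
  exact: ler_wpM2l.
have [epsb0 b1B] := hpos pp; apply/andP; split.
  apply: le_trans (power_mean_ge _ pp u0); apply: le_trans epsb0 _.
  exact: ler_wpM2l.
apply: (@le_trans _ _ (mean B B)); last by rewrite power_mean_diag.
apply: le_power_mean => //.
exact: le_trans ub1 b1B.
Qed.

(** By continuity in [w] the strict inequality persists at a rational slightly below [w], which
    turns superlevel sets into countable unions. *)
Lemma power_mean_gtP (c u w : R) : 0 < u -> 0 < w ->
  c < mean u w <-> exists b : rat, (0 : R) < ratr b < w /\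
    c < mean u (ratr b).
Proof.
move=> u0 w0; split; last first.
  move=> [b [/andP[b0 bw] cb]]; apply: lt_le_trans cb _.
  by apply: le_power_mean => //; exact: ltW.
move=> cw.
have mean_cont : {for w, continuous (mean u)}.
  apply: (@continuous_comp _ _ _
    (fun x => (1 - beta) * u `^ p + beta * x `^ p) (@powR R ^~ p^-1));
    last exact/powR_continuous/mean_base_gt0.
  apply: (cvgD (cvg_cst _)).
  exact: (cvgM (cvg_cst beta) (powR_continuous w0)).
have : \forall x \near w, c < mean u x.
  exact: (@cvgr_gt _ _ _ _ (mean u) _ mean_cont).
move=> /nbhs_ballP[e /= e0 we].
have [b] : exists b : rat, ratr b \in `]Num.max 0 (w - e), w[.
  by apply: rat_in_itvoo; rewrite gt_max w0 gtrBl.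
rewrite in_itv/= gt_max => /andP[/andP[b0 web] bw].
exists b; split; first by rewrite b0 bw.
apply: (we (ratr b)); rewrite -ball_normE /= gtr0_norm ?subr_gt0//.
by rewrite ltrBlDr addrC -ltrBlDr.
Qed.

End power_mean.

(** * Certainty equivalents *)

Section certainty_equivalent_theory.
Variables (R : realType) (S A : ptopologicalType) (K : borelSubset (S * A)%type).
Variables (q : R.-pker (borel K) ~> (borel S)) (r eps B : R).
Hypotheses (r0 : r < 0) (eps0 : 0 < eps).

Local Notation usa v := (upper_suslin (@borel_set S) v).

Definition bounded_usa (v : S -> R) := usa v /\ forall s, eps <= v s <= B.

(* The certainty equivalent is an increasing function of the integral of the
   loss, and unlike [expR (r * v)] the loss is upper semianalytic. *)
Definition loss (v : S -> R) (s : borel S) : R := 1 - expR (r * v s).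

Local Notation expected_loss v k := (fine (completed_integral (q k) (loss v))).

Implicit Types v w : S -> R.

Lemma loss01 v s : bounded_usa v -> 0 <= loss v s <= 1.
Proof.
move=> [_ /(_ s)/andP[ev _]]; rewrite /loss subr_ge0 gerBl expR_ge0 andbT -expR0 ler_expR.
by rewrite nmulr_rle0// ltW// (lt_le_trans eps0).
Qed.

Lemma le_loss v w s : v s <= w s -> loss v s <= loss w s.
Proof. by move=> vw; rewrite lerD2l lerN2 ler_expR ler_nM2l. Qed.

Lemma upper_suslin_loss v : usa v -> upper_suslin (@borel_set S) (loss v).
Proof.
(* The loss stays below 1, so for [c >= 1] the set is empty; otherwise [ln (1 - c)] is
   meaningful. *)
move=> sv c; have [c1|c1] := ltP c 1; last first.
  rewrite (_ : mkset _ = set0); first by apply: sub_suslin; exact: sigma_algebra0.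
  apply/seteqP; split => // s /=; rewrite /loss ltrBrDr => h.
  have := lt_le_trans h c1.
  by rewrite gtrDl ltNge expR_ge0.
rewrite (_ : mkset _ = [set s | ln (1 - c) / r < v s])//.
apply/funext => s /=; apply/propext.
have -> : (c < loss v s) = (expR (r * v s) < 1 - c).
  by rewrite /loss ltrBrDr addrC -ltrBrDr.
rewrite -{1}[1 - c]lnK ?posrE ?subr_gt0// ltr_expR.
by rewrite ltr_ndivrMr// mulrC.
Qed.

Let qT k : q k setT = 1%E. Proof. exact: prob_kernel. Qed.
Let q_fin k : (q k setT < +oo)%E. Proof. by rewrite qT ltry. Qed.

Lemma measurable_loss v k : usa v ->
  measurable_fun [set: caratheodory_type ((q k)^*)%mu] (EFin \o loss v).
Proof.
move=> /upper_suslin_loss sl.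
by apply/measurable_EFinP; exact: (upper_suslin_measurable (q_fin k)).
Qed.

Lemma expected_loss_fin v k : bounded_usa v ->
  completed_integral (q k) (loss v) \is a fin_num.
Proof.
move=> bv; apply: completed_integral_fin_num => //.
  exact: upper_suslin_loss bv.1.
by move=> s; exact: loss01.
Qed.

Lemma integral_expR_loss v k : bounded_usa v ->
  fine (completed_integral (q k) (fun s => expR (r * v s))) =
  1 - expected_loss v k.
Proof.
move=> [sv vb].
have ml := measurable_loss (k := k) sv.
have expE s : expR (r * v s) = 1 - loss v s by rewrite /loss opprB addrC subrK.
have mexp : measurable_fun [set: caratheodory_type ((q k)^*)%mu]
    (EFin \o (fun s => expR (r * v s))).
  apply/measurable_EFinP; rewrite (_ : (fun _ => _) = cst 1 \- loss v).
    by apply: measurable_funB; [exact: measurable_cst|exact/measurable_EFinP].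
  by apply/funext => s /=; rewrite expE.
have fl := expected_loss_fin k (conj sv vb).
have : (completed_integral (q k) (fun s => expR (r * v s)) +
        completed_integral (q k) (loss v) = 1%:E)%E.
  rewrite -[RHS](completed_integral_cst (qT k)) /completed_integral.
  rewrite -ge0_integralD//.
  - by apply: eq_integral => s _; rewrite -EFinD expE subrK.
  - by move=> s _; rewrite lee_fin; case/andP: (loss01 s (conj sv vb)).
move=> /(congr1 (fun x => x - completed_integral (q k) (loss v))%E).
by rewrite addeK// => ->; rewrite -{1}(fineK fl).
Qed.

Lemma le_expected_loss v w k : bounded_usa v -> bounded_usa w ->
  (forall s, v s <= w s) -> expected_loss v k <= expected_loss w k.
Proof.
move=> bv bw vw; apply: fine_le; [exact: expected_loss_fin..|].
rewrite /completed_integral; apply: ge0_le_integral; first exact: measurableT.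
- by move=> s _; rewrite lee_fin; case/andP: (loss01 s bv).
- exact: measurable_loss bv.1.
- exact: measurable_loss bw.1.
- by move=> s _; rewrite lee_fin; exact: le_loss.
Qed.

(** The factor [r^-1] and the passage from the exponential to the loss both reverse the order, so
    the two inequalities point the same way. *)
Lemma certainty_equivalent_gtP v k b : bounded_usa v ->
  b < certainty_equivalent q r v k <-> 1 - expR (r * b) < expected_loss v k.
Proof.
move=> bv; rewrite /certainty_equivalent integral_expR_loss//.
have [cB bound] : bounded_usa (fun=> B) /\ forall s, v s <= B.
  split; last by move=> s; case/andP: (bv.2 s).
  split; first by apply: upper_suslin_cst; [exact: borel_setT|exact: sigma_algebra0].
  by move=> s; rewrite lexx andbT; case/andP: (bv.2 s); exact: le_trans.
(* Comparison with the constant [B] keeps the argument of the logarithm positive. *)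
have lt1 : expected_loss v k < 1.
  apply: le_lt_trans (le_expected_loss k bv cB bound) _.
  by rewrite [loss _]/loss completed_integral_cst//= gtrBl expR_gt0.
rewrite mulrC ltr_ndivlMr// mulrC -ltr_expR lnK ?posrE ?subr_gt0//.
by rewrite ltrBlDr addrC -ltrBlDr.
Qed.

Lemma le_certainty_equivalent v w k : bounded_usa v -> bounded_usa w ->
  (forall s, v s <= w s) ->
  certainty_equivalent q r v k <= certainty_equivalent q r w k.
Proof.
move=> bv bw vw; rewrite leNgt; apply/negP => /(certainty_equivalent_gtP _ _ bv).
move=> /lt_le_trans /(_ (le_expected_loss k bv bw vw)).
by move=> /(certainty_equivalent_gtP _ _ bw); rewrite ltxx.
Qed.

Lemma certainty_equivalent_cst k c : certainty_equivalent q r (fun=> c) k = c.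
Proof.
rewrite /certainty_equivalent (completed_integral_cst (qT k) (expR (r * c))).
rewrite [fine _]/= expRK.
by rewrite mulKf// lt_eqF.
Qed.

Lemma bounded_usa_cst c : eps <= c <= B -> bounded_usa (fun=> c).
Proof.
by split => //; apply: upper_suslin_cst; [exact: borel_setT|exact: sigma_algebra0].
Qed.

Lemma certainty_equivalent_bounds v k : bounded_usa v ->
  eps <= certainty_equivalent q r v k <= B.
Proof.
move=> bv; have epsB : eps <= B.
  by case/andP: (bv.2 point); exact: le_trans.
apply/andP; split.
  rewrite -[leLHS](certainty_equivalent_cst k).
  apply: le_certainty_equivalent => //; first by apply: bounded_usa_cst; rewrite lexx.
  by move=> s; case/andP: (bv.2 s).
rewrite -[leRHS](certainty_equivalent_cst k).
apply: le_certainty_equivalent => //; first by apply: bounded_usa_cst; rewrite epsB/=.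
by move=> s; case/andP: (bv.2 s).
Qed.

Lemma upper_suslin_certainty_equivalent v : bounded_usa v ->
  upper_suslin (@borel_set K) (certainty_equivalent q r v).
Proof.
move=> bv b; rewrite (_ : mkset _ =
    [set k | 1 - expR (r * b) < fine (completed_integral (q k) (loss v))]).
  apply: (upper_suslin_integral q); first by move=> s; exact: loss01.
  exact: upper_suslin_loss bv.1.
by apply/funext => k; apply/propext; exact: certainty_equivalent_gtP.
Qed.

(** * Continuity along increasing sequences *)

Section increasing_limit.
Variables (v_ : nat -> S -> R) (v : S -> R).
Hypotheses (bv_ : forall n, bounded_usa (v_ n))
  (nd_v : forall s, nondecreasing_seq (v_^~ s))
  (cvg_v : forall s, v_ n s @[n --> \oo] --> v s).

Lemma increasing_limit_gt s c : c < v s -> exists n, c < v_ n s.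
Proof.
move=> cv; have [n _ nP] := @cvgr_gt _ _ _ _ (v_^~ s) _ (@cvg_v s) _ cv.
by exists n; apply: nP => /=.
Qed.

Lemma increasing_limit_ge n s : v_ n s <= v s.
Proof.
rewrite -(cvg_lim _ (@cvg_v s))//; apply: nondecreasing_cvgn_le => //.
by apply/cvg_ex; exists (v s).
Qed.

Lemma bounded_usa_increasing_limit : bounded_usa v.
Proof.
split => [c|s]; last first.
  apply/andP; split.
    by case/andP: ((bv_ 0).2 s) => + _; move/le_trans; apply; exact: increasing_limit_ge.
  rewrite leNgt; apply/negP => /increasing_limit_gt[n].
  by rewrite ltNge; case/andP: ((bv_ n).2 s) => _ ->.
rewrite (_ : mkset _ = \bigcup_n [set s | c < v_ n s]).
  by apply: suslin_bigcup; [exact: borel_setT|move=> n; exact: (bv_ n).1].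
apply/seteqP; split => s /=; first by move=> /increasing_limit_gt[n]; exists n.
by move=> [n _ /lt_le_trans]; apply; exact: increasing_limit_ge.
Qed.

Lemma certainty_equivalent_increasing_limit_gt k b :
  b < certainty_equivalent q r v k ->
  exists n, b < certainty_equivalent q r (v_ n) k.
Proof.
have bv := bounded_usa_increasing_limit.
move=> /(certainty_equivalent_gtP _ _ bv) bJ.
suff [n bn] : exists n, 1 - expR (r * b) < expected_loss (v_ n) k.
  by exists n; apply/certainty_equivalent_gtP.
apply: contrapT => /forallNP nb; move: bJ; apply/negP; rewrite -leNgt.
(* The losses are nonnegative and increase with [n], so monotone convergence applies to the
   completed measure. *)
have cvgJ : completed_integral (q k) (loss (v_ n)) @[n --> \oo] -->
    completed_integral (q k) (loss v).
  pose T := caratheodory_type ((q k)^*)%mu.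
  pose g n (t : T) := (loss (v_ n) t)%:E.
  have mg n : measurable_fun setT (g n) by exact: measurable_loss (bv_ n).1.
  have g0 n t : setT t -> (0 <= g n t)%E.
    by move=> _; rewrite lee_fin; case/andP: (loss01 t (bv_ n)).
  have ndg t : setT t -> {homo g^~ t : m n / (m <= n)%N >-> (m <= n)%E}.
    by move=> _ m n mn; rewrite lee_fin le_loss// nd_v.
  have := cvg_monotone_convergence
    (mu := @completed_measure_extension _ _ _ (q k)) measurableT mg g0 ndg.
  rewrite (_ : (fun t => limn (g^~ t)) = EFin \o loss v)//.
  apply/funext => t; apply/cvg_lim => //.
  apply: cvg_EFin; first exact: nearW.
  have expv : expR (r * v_ n t) @[n --> \oo] --> expR (r * v t).
    apply: continuous_cvg; first exact: continuous_expR.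
    exact: (cvgM (cvg_cst r) (@cvg_v t)).
  by have := cvgB (cvg_cst (1 : R)) expv; apply.
rewrite -lee_fin fineK ?expected_loss_fin//.
rewrite -(cvg_lim _ cvgJ)//; apply: lime_le; first by apply/cvg_ex; eexists; exact: cvgJ.
apply: nearW => n; rewrite -(fineK (expected_loss_fin k (bv_ n))) lee_fin.
by rewrite leNgt; apply/negP; exact: nb.
Qed.

End increasing_limit.

End certainty_equivalent_theory.

(** * The Bellman operator *)

Section bellman_operator.
Variables (R : realType) (X Y : completeMetricType R).
Hypotheses (hX : separable X) (hY : separable Y).
Variables (S : borelSubset X) (A : borelSubset Y) (K : borelSubset (S * A)%type).
Hypothesis hK : forall s : S, actions K s !=set0.
Variables (q : R.-pker (borel K) ~> (borel S)) (b0 b1 : R).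
Hypothesis hb0 : 0 < b0.
Variable u : K -> R.
Hypotheses (hu : measurable_fun [set: borel K] u) (hub : forall k, b0 <= u k <= b1).
Variables (beta r p : R).
Hypotheses (hbeta : 0 <= beta < 1) (hr : r < 0) (hp0 : p != 0).
Variables (eps B : R).
Hypotheses (heps : 0 < eps) (hepsB : eps <= B).
Hypothesis hneg : p < 0 -> eps <= b0 /\ (1 - beta) `^ p^-1 * b1 <= B.
Hypothesis hpos : 0 < p -> eps <= (1 - beta) `^ p^-1 * b0 /\ b1 <= B.

Local Notation ce := (certainty_equivalent q r).
Local Notation agg := (aggregate q u beta r p).
Local Notation bounded_usa := (@bounded_usa R S eps B).

Implicit Types (v w : S -> R) (k : K).

Let aggE v k : agg v k = power_mean beta p (u k) (ce v k). Proof. by []. Qed.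

Let u_gt0 k : 0 < u k.
Proof. by apply: lt_le_trans hb0 _; case/andP: (hub k). Qed.

Let ce_bounds v k : bounded_usa v -> eps <= ce v k <= B.
Proof. exact: certainty_equivalent_bounds. Qed.

Let ce_gt0 v k : bounded_usa v -> 0 < ce v k.
Proof. by move=> /(ce_bounds k)/andP[/(lt_le_trans heps)]. Qed.

Lemma aggregate_bounds v k : bounded_usa v -> eps <= agg v k <= B.
Proof.
move=> bv; rewrite aggE.
exact: (power_mean_bounds hbeta hp0 heps hb0 hneg hpos (hub k) (ce_bounds k bv)).
Qed.

Lemma le_aggregate v w k : bounded_usa v -> bounded_usa w ->
  (forall s, v s <= w s) -> agg v k <= agg w k.
Proof.
move=> bv bw vw; rewrite !aggE.
apply: (le_power_mean hbeta hp0 (u_gt0 k) (lexx _) (ce_gt0 k bv)).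
exact: (le_certainty_equivalent q hr heps k bv bw vw).
Qed.

(** A positive rational [b] separates the two arguments: [b] below the certainty equivalent is a
    Souslin condition, and the mean of [u k] and [b] is Borel in [k]. *)
Lemma upper_suslin_aggregate v : bounded_usa v ->
  upper_suslin (@borel_set K) (agg v).
Proof.
move=> bv c; rewrite (_ : mkset _ = \bigcup_(b in [set b : rat | 0 < ratr b :> R])
    ([set k | ratr b < ce v k] `&` [set k | c < power_mean beta p (u k) (ratr b)])).
  apply: suslin_bigcup_countable => [||b b_gt0]; first exact: borel_setT.
    exact: sigma_algebra0.
  apply: suslinI; first exact: borel_setT.
    exact: (upper_suslin_certainty_equivalent q hr heps bv).
  apply: sub_suslin.
  have mm : measurable_fun [set: borel K]
      (fun k => power_mean beta p (u k) (ratr b)).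
    apply: (measurableT_comp (measurable_powR _)).
    apply: measurable_funD => //; apply: measurable_funM => //.
    exact: (measurableT_comp (measurable_powR _)).
  rewrite (_ : mkset _ = [set: borel K] `&`
    (fun k => power_mean beta p (u k) (ratr b)) @^-1` `]c, +oo[).
    by apply: mm => //; exact: measurable_itv.
  by rewrite setTI; apply/seteqP; split => k /=; rewrite in_itv/= andbT.
apply/seteqP; split => k /=.
  move/(power_mean_gtP hbeta hp0 _ (u_gt0 k) (ce_gt0 k bv)).
  by move=> [b [/andP[b_gt0 bce] cb]]; exists b.
move=> [b /= b_gt0 [bce cb]].
apply/(power_mean_gtP hbeta hp0 _ (u_gt0 k) (ce_gt0 k bv)).
by exists b; rewrite b_gt0.
Qed.

Definition bellman_set v (s : S) : set \bar R := [set y | exists (a : A)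
  (Ka : actions K s a), y = (agg v (to_subtype Ka))%:E].

Definition bellman_operator v (s : S) : R := fine (ereal_sup (bellman_set v s)).

Lemma bellman_set_sup_bounds v s : bounded_usa v ->
  (eps%:E <= ereal_sup (bellman_set v s) <= B%:E)%E.
Proof.
move=> bv; apply/andP; split; last first.
  apply: ge_ereal_sup => _ [a [Ka ->]]; rewrite lee_fin.
  by case/andP: (aggregate_bounds (to_subtype Ka) bv).
have [a Ka] := hK s; apply: (@le_trans _ _ (agg v (to_subtype Ka))%:E).
  by rewrite lee_fin; case/andP: (aggregate_bounds (to_subtype Ka) bv).
by apply: ereal_sup_ubound; exists a, Ka.
Qed.

Lemma bellman_operatorE v s : bounded_usa v ->
  (bellman_operator v s)%:E = ereal_sup (bellman_set v s).
Proof.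
move=> bv; have /andP[lo hi] := bellman_set_sup_bounds s bv.
rewrite fineK//; apply/fin_real.
by rewrite (lt_le_trans _ lo) ?ltNyr// (le_lt_trans hi) ?ltry.
Qed.

Lemma bellman_operator_gtP v s c : bounded_usa v -> c < bellman_operator v s <->
  exists (a : A) (Ka : actions K s a), c < agg v (to_subtype Ka).
Proof.
move=> bv; rewrite -lte_fin bellman_operatorE//; split.
  by move=> /ereal_sup_gt[_ [a [Ka ->]]]; rewrite lte_fin => ?; exists a, Ka.
move=> [a [Ka cagg]]; apply: (@lt_le_trans _ _ (agg v (to_subtype Ka))%:E).
  by rewrite lte_fin.
by apply: ereal_sup_ubound; exists a, Ka.
Qed.

(** A supremum exceeds [c] iff some action does, so its superlevel sets are projections of those of
    the aggregate. *)
Lemma bounded_usa_bellman_operator v :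
  bounded_usa v -> bounded_usa (bellman_operator v).
Proof.
move=> bv; split => [c|s]; last first.
  by rewrite -!lee_fin bellman_operatorE//; exact: bellman_set_sup_bounds.
rewrite (_ : mkset _ = [set s | exists (a : A) (Ka : actions K s a),
    [set k | c < agg v k] (to_subtype Ka)]).
  by apply: suslin_projection => //; exact: upper_suslin_aggregate.
by apply/funext => s; apply/propext; exact: bellman_operator_gtP.
Qed.

Lemma le_bellman_operator v w s : bounded_usa v -> bounded_usa w ->
  (forall s, v s <= w s) -> bellman_operator v s <= bellman_operator w s.
Proof.
move=> bv bw vw; rewrite leNgt; apply/negP.
move=> /(bellman_operator_gtP _ _ bv)[a [Ka]].
move=> /lt_le_trans/(_ (le_aggregate (to_subtype Ka) bv bw vw)) h.
have : bellman_operator w s < bellman_operator w s.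
  by apply/(bellman_operator_gtP _ _ bw); exists a, Ka.
by rewrite ltxx.
Qed.

Definition bellman_iterate n : S -> R := iter n bellman_operator (fun=> eps).

Lemma bounded_usa_bellman_iterate n : bounded_usa (bellman_iterate n).
Proof.
elim: n => [|n IH]; last exact: bounded_usa_bellman_operator.
by apply: bounded_usa_cst; rewrite lexx.
Qed.

Lemma nondecreasing_bellman_iterate s :
  nondecreasing_seq (bellman_iterate ^~ s).
Proof.
apply/nondecreasing_seqP => n; elim: n s => [|n IH] s.
  by case/andP: ((bounded_usa_bellman_iterate 1).2 s).
exact: (le_bellman_operator s (bounded_usa_bellman_iterate n)
  (bounded_usa_bellman_iterate n.+1) IH).
Qed.

Definition bellman_solution (s : S) : R := limn (bellman_iterate ^~ s).

Lemma cvg_bellman_iterate s :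
  bellman_iterate n s @[n --> \oo] --> bellman_solution s.
Proof.
apply: nondecreasing_is_cvgn; first exact: nondecreasing_bellman_iterate.
by exists B => _ [n _ <-]; case/andP: ((bounded_usa_bellman_iterate n).2 s).
Qed.

Lemma bounded_usa_bellman_solution : bounded_usa bellman_solution.
Proof.
exact: bounded_usa_increasing_limit bounded_usa_bellman_iterate
  nondecreasing_bellman_iterate cvg_bellman_iterate.
Qed.

(** The supremum over actions commutes with the increasing limit. A strict excess of the left side
    occurs at one action, survives at a rational below the certainty equivalent, hence at a finite
    stage [n], and would push iterate [n.+1] above the limit. The converse inequality is
    monotonicity. *)
Lemma bellman_solution_fixpoint s :
  bellman_operator bellman_solution s = bellman_solution s.
Proof.
have bsol := bounded_usa_bellman_solution.
have ge_iter n t : bellman_iterate n t <= bellman_solution t.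
  exact: increasing_limit_ge nondecreasing_bellman_iterate cvg_bellman_iterate _ _.
apply/eqP; rewrite eq_le; apply/andP; split; rewrite leNgt; apply/negP.
  move=> /(bellman_operator_gtP _ _ bsol)[a [Ka]]; set k := to_subtype Ka.
  move=> /(power_mean_gtP hbeta hp0 _ (u_gt0 k) (ce_gt0 k bsol)).
  move=> [b [/andP[b_gt0 bce] cb]].
  have [n bn] := certainty_equivalent_increasing_limit_gt hr heps
    bounded_usa_bellman_iterate nondecreasing_bellman_iterate
    cvg_bellman_iterate bce.
  have : bellman_solution s < bellman_iterate n.+1 s.
    apply/(bellman_operator_gtP _ _ (bounded_usa_bellman_iterate n)).
    exists a, Ka; apply: lt_le_trans cb _; rewrite aggE.
    exact: (le_power_mean hbeta hp0 (u_gt0 k) (lexx _) b_gt0 (ltW bn)).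
  by rewrite ltNge ge_iter.
move=> lt; have [n] := increasing_limit_gt cvg_bellman_iterate lt.
apply/negP; rewrite -leNgt; apply: (@le_trans _ _ (bellman_iterate n.+1 s)).
  exact: nondecreasing_bellman_iterate.
exact: (le_bellman_operator s (bounded_usa_bellman_iterate n) bsol (ge_iter n)).
Qed.

End bellman_operator.

Theorem theorem1 (R : realType)
  (X Y : completeMetricType R) (hX : separable X) (hY : separable Y)
  (S : borelSubset X) (A : borelSubset Y)
  (K : borelSubset (S * A)%type) (hK : forall s : S, actions K s !=set0)
  (q : R.-pker (borel K) ~> (borel S))
  (b0 b1 : R) (hb0 : 0 < b0) (hb01 : b0 < b1)
  (u : K -> R) (hu : measurable_fun [set: borel K] u)
  (hub : forall k : K, b0 <= u k <= b1)
  (beta r p : R) (hbeta : 0 <= beta < 1) (hr : r < 0)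
  (hp1 : p < 1) (hp0 : p != 0)
  (eps B : R) (heps : 0 < eps) (hepsB : eps < B)
  (hneg : p < 0 -> eps <= b0 /\ (1 - beta) `^ p^-1 * b1 <= B)
  (hpos : 0 < p -> eps <= (1 - beta) `^ p^-1 * b0 /\ b1 <= B) :
  exists v : S -> R, value_class eps B v /\ bellman_equation q u beta r p v.
Proof.
exists (bellman_solution q u beta r p eps).
have bsol : bounded_usa eps B (bellman_solution q u beta r p eps).
  exact: (bounded_usa_bellman_solution hX hY hK q hb0 hu hub hbeta hr hp0 heps
    (ltW hepsB) hneg hpos).
split.
  by split => [c|s]; [apply: suslin_analytic => //; exact: bsol.1|exact: bsol.2].
move=> s; rewrite -[in LHS](bellman_solution_fixpoint hX hY hK q hb0 hu hub
  hbeta hr hp0 heps (ltW hepsB) hneg hpos).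
exact: (bellman_operatorE hK q hb0 hub hbeta hr hp0 heps hneg hpos).
Qed.
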